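(* Let $L\in\mathbb{R}^{N\times N}$ be positive definite, $\mathbf{b}\in\mathbb{R}^N$, $f\in\mathcal{SB}=\mathcal{LS}\cup\mathcal{CS}\cup\mathcal{CB}$, let $\Xi=\{\xi_1,\dots,\xi_k\}\subset-\Sigma$ be a set of $k$ pairwise distinct poles, $V$ a matrix whose columns form a basis of $\mathcal{Q}_{k+1}^\Xi(L,\mathbf{b})$, $L_{k+1}=V^\dagger LV$, and $\mathbf{u}_{k+1}=Vf(L_{k+1})V^\dagger\mathbf{b}$. Then $$\|f(L)\mathbf{b}-\mathbf{u}_{k+1}\|\le 2C\,c_k\,\|\mathbf{b}\|\,\|r_\Xi\|_\Sigma,$$ where, with $f(0^+):=\lim_{\lambda\to0^+}f(\lambda)$, $$c_k:=\begin{cases}4\gamma_k f(0^+), & \text{if } f\in\mathcal{LS},\\ f(\lambda_{\min}), & \text{if } f\in\mathcal{CS},\\ f(\lambda_{\max}), & \text{if } f\in\mathcal{CB}.\end{cases}$$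
   Context: $\mathbb{R}^+=(0,\infty)$. $L\in\mathbb{R}^{N\times N}$ is a diagonalizable positive definite matrix with smallest and largest eigenvalues $\lambda_{\min},\lambda_{\max}$; $\Sigma=[\lambda_{\min},\lambda_{\max}]$. $\|\cdot\|$ is the Euclidean norm (and induced matrix norm), $\|\cdot\|_\Sigma$ the maximum norm on $\Sigma$. For poles $\Xi=\{\xi_1,\dots,\xi_k\}$: $q_k(\lambda)=\prod_{j=1}^k(\lambda-\xi_j)$, $\mathcal{Q}_{k+1}^\Xi(L,\mathbf{b})=q_k(L)^{-1}\operatorname{span}\{\mathbf{b},L\mathbf{b},\dots,L^k\mathbf{b}\}$, and $r_\Xi(\lambda)=\prod_{j=1}^k\frac{\lambda+\xi_j}{\lambda-\xi_j}$. $V\in\mathbb{C}^{N\times(k+1)}$, and $V^\dagger$ is the Moore-Penrose inverse of $V$. $C\le 11.08$ is the absolute constant of Crouzeix's estimate $\|f(L)\|\le 2C\|f\|_\Sigma$ and of the quasi-optimality estimate $\|f(L)\mathbf{b}-Vf(L_{k+1})V^\dagger\mathbf{b}\|\le 2C\|\mathbf{b}\|\min_{p\in\mathcal{P}_k}\|f-p/q_k\|_\Sigma$ ($\mathcal{P}_k$: polynomials of degree at most $k$); if $L$ is self-adjoint, $C=1$. $\gamma_k=2.23+\frac{2}{\pi}\ln\Big(4k\sqrt{\frac{\lambda_{\max}}{\lambda_{\min}\pi}}\Big)$. Function classes for $f:\mathbb{R}^+\to\mathbb{R}$: $f\in\mathcal{LS}$ (Laplace-Stieltjes) if $f(\lambda)=\int_0^\infty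 e^{-\zeta\lambda}\mu_L(\zeta)\,d\zeta$ for a positive $\mu_L$ with absolutely convergent integral, where $\mu_L(\zeta)d\zeta$ may be a positive measure on $[0,\infty)$, so that $\mathcal{LS}$ is the set of completely monotonic functions; $f\in\mathcal{CS}$ (Cauchy-Stieltjes) if $f(\lambda)=\int_0^\infty\frac{\mu_C(\zeta)}{\zeta+\lambda}\,d\zeta$ for a positive real-valued function $\mu_C$ with absolutely convergent integral; $f\in\mathcal{CB}$ (complete Bernstein) if $f(\lambda)=\int_0^\infty\frac{\lambda}{\zeta+\lambda}\mu_B(\zeta)\,d\zeta$ for a positive real-valued function $\mu_B$ with absolutely convergent integral.
   Formalization: For non-symmetric L no absolute C ≤ 11.08 satisfies the quoted estimates over Σ and the bound can fail; so for such L, C is any constant ≤ 11.08 for which both quoted estimates are assumed for the given L, b, Ξ, V; for symmetric L, C = 1 and nothing is assumed. *)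

(* Defs.v *)
From HB Require Import structures.
From mathcomp Require Import all_boot all_order all_algebra complex.
From mathcomp Require Import all_classical all_reals all_analysis.
Set Implicit Arguments.
Unset Strict Implicit.
Unset Printing Implicit Defensive.
Import Order.TTheory GRing.Theory Num.Theory.
Import numFieldNormedType.Exports.
Local Open Scope classical_set_scope.
Local Open Scope ring_scope.
Local Open Scope complex_scope.

Section Matrices.
Context {R : realType}.
Local Notation C := R[i].

Definition mxC m n (A : 'M[R]_(m, n)) : 'M[C]_(m, n) := map_mx (real_complex R) A.

Definition posdefmx n (L : 'M[R]_n) : Prop :=
  forall x : 'cV[R]_n, x != 0 -> 0 < (x^T *m L *m x) 0 0.

(* The set of eigenvalues is finite, so inf and sup are min and max. *)
Definition lambda_min n (L : 'M[R]_n) : R := inf [set a | eigenvalue L a].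
Definition lambda_max n (L : 'M[R]_n) : R := sup [set a | eigenvalue L a].

Definition norm2 n (x : 'cV[C]_n) : R :=
  Num.sqrt (\sum_i (complex.Re (x i 0) ^+ 2 + complex.Im (x i 0) ^+ 2)).

Definition opnorm n (A : 'M[C]_n) : R :=
  sup [set norm2 (A *m x) | x in [set x | norm2 x <= 1]].

Definition adjmx m n (A : 'M[C]_(m, n)) : 'M[C]_(n, m) := map_mx conjc A^T.

Definition penrose m n (A : 'M[C]_(m, n)) (X : 'M[C]_(n, m)) : Prop :=
  [/\ A *m X *m A = A, X *m A *m X = X,
      adjmx (A *m X) = A *m X & adjmx (X *m A) = X *m A].

(* The Moore-Penrose inverse: the unique matrix satisfying the four Penrose
   equations. MathComp's pinvmx is only some generalized inverse. *)
Definition mpinv m n (A : 'M[C]_(m, n)) : 'M[C]_(n, m) :=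
  xget 0 [set X | penrose A X].

(* Complex derivatives are taken in R[i] as a normed module over itself. *)
Definition cfun_regular (F : C -> C) :
  (C : numFieldType)^o -> (C : numFieldType)^o := F.

(* F(A) as a primary matrix function: p(A) for any polynomial p that
   Hermite-interpolates F on the spectrum of A, up to the multiplicity of each
   eigenvalue in the minimal polynomial. All such p give the same matrix. *)
Definition matfun (F : C -> C) n (A : 'M[C]_n.+1) : 'M[C]_n.+1 :=
  xget 0 [set B | exists p : {poly C}, B = horner_mx A p /\
    forall (z : C) (j : nat), (j < mup z (mxminpoly A))%N ->
      (derivn j p).[z] = derive1n j (cfun_regular F) z].

(* F is the (unique) holomorphic extension of f from (0,oo) to the open right
   half-plane, which contains the spectrum of every compression of a positive
   definite matrix. *)
Definition holo_ext (f : R -> R) (F : C -> C) : Prop :=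
  (forall x : R, 0 < x -> F x%:C = (f x)%:C) /\
  (forall z : C, 0 < complex.Re z -> derivable (cfun_regular F) z 1).

End Matrices.

Section Functions.
Context {R : realType}.

(* Of f : R -> R, only the values on (0,oo) matter. In all three classes the
   integral is required to converge absolutely for every x > 0. *)
Definition LS (f : R -> R) : Prop :=
  exists mu : {measure set (measurableTypeR R) -> \bar R},
    forall x : R, 0 < x ->
      mu.-integrable (`[0, +oo[ : set R) (fun z : R => (expR (- z * x))%:E) /\
      (f x)%:E = (\int[mu]_(z in `[0%R, +oo[) (expR (- z * x))%:E)%E.

Definition density (w : R -> R) : Prop :=
  measurable_fun (`]0, +oo[ : set R) w /\ forall z : R, 0 < z -> 0 <= w z.

Definition CS (f : R -> R) : Prop :=
  exists2 w : R -> R, density w &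
    forall x : R, 0 < x ->
      (@lebesgue_measure R).-integrable (`]0, +oo[ : set R) (fun z => (w z / (z + x))%:E) /\
      (f x)%:E = (\int[@lebesgue_measure R]_(z in `]0%R, +oo[) (w z / (z + x))%:E)%E.

Definition CB (f : R -> R) : Prop :=
  exists2 w : R -> R, density w &
    forall x : R, 0 < x ->
      (@lebesgue_measure R).-integrable (`]0, +oo[ : set R) (fun z => (x / (z + x) * w z)%:E) /\
      (f x)%:E = (\int[@lebesgue_measure R]_(z in `]0%R, +oo[) (x / (z + x) * w z)%:E)%E.

Definition SB (f : R -> R) : Prop := [\/ LS f, CS f | CB f].

Definition supnorm (a b : R) (g : R -> R) : R := sup [set `|g x| | x in `[a, b]].

Definition gamma (lmin lmax : R) (k : nat) : R :=
  223 / 100 + 2 / pi * ln (4 * k%:R * Num.sqrt (lmax / (lmin * pi))).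

(* The classes overlap, so the constant is a relation: every case that applies
   is admitted. f(0+) may be +oo. *)
Definition error_constant (f : R -> R) (lmin lmax : R) (k : nat) (c : \bar R) : Prop :=
  [\/ LS f /\ c = ((4 * gamma lmin lmax k)%:E * lim ((f x)%:E @[x --> 0^'+]))%E,
      CS f /\ c = (f lmin)%:E
    | CB f /\ c = (f lmax)%:E].

End Functions.

Section Krylov.
Context {R : realType}.
Local Notation C := R[i].
Variables (n k : nat) (L : 'M[R]_n.+1) (b : 'cV[R]_n.+1) (xi : 'I_k -> R).

Definition qpoly : {poly R} := \prod_j ('X - (xi j)%:P).

Definition rfun (x : R) : R := \prod_j ((x + xi j) / (x - xi j)).

(* The rational Krylov space is the row space of this matrix, whose j-th row
   is the transpose of q(L)^-1 L^j b. *)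
Definition rat_krylov : 'M[R]_(k.+1, n.+1) :=
  \matrix_(j < k.+1) (invmx (horner_mx L qpoly) *m L ^+ j *m b)^T.

Definition rat_krylov_basis (V : 'M[C]_(n.+1, k.+1)) : bool :=
  row_free V^T && (V^T == mxC rat_krylov)%MS.

Variable V : 'M[C]_(n.+1, k.+1).

Definition compression : 'M[C]_k.+1 := mpinv V *m mxC L *m V.

Definition krylov_approx (F : C -> C) : 'cV[C]_n.+1 :=
  V *m matfun F compression *m mpinv V *m mxC b.

Definition krylov_error (F : C -> C) : R :=
  norm2 (matfun F (mxC L) *m mxC b - krylov_approx F).

Definition sigma_norm (g : R -> R) : R := supnorm (lambda_min L) (lambda_max L) g.

Definition best_approx (f : R -> R) : R :=
  inf [set sigma_norm (fun x => f x - p.[x] / qpoly.[x])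
      | p in [set p : {poly R} | (size p <= k.+1)%N]].

Definition crouzeix_estimate (K : R) : Prop :=
  forall (f : R -> R) (F : C -> C), holo_ext f F ->
    opnorm (matfun F (mxC L)) <= 2 * K * sigma_norm f.

Definition quasi_optimality (K : R) : Prop :=
  forall (f : R -> R) (F : C -> C), holo_ext f F ->
    krylov_error F <= 2 * K * norm2 (mxC b) * best_approx f.

(* For self-adjoint L the constant is 1 and nothing is assumed. Otherwise no
   absolute constant validates the two estimates with the maximum norm on the
   spectral interval for all L, so they are required of the given L. *)
Record crouzeix_constant (K : R) : Prop := CrouzeixConstant {
  crouzeix_bound : K <= 1108 / 100;
  crouzeix_selfadjoint : L^T = L -> K = 1;
  crouzeix_functional : L^T <> L -> crouzeix_estimate K;
  crouzeix_quasi_optimality : L^T <> L -> quasi_optimality K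
}.

End Krylov.

(* Main.v *)
Require Import Defs.
From mathcomp Require Import all_boot all_order all_algebra complex.
From mathcomp Require Import all_classical all_reals all_analysis.
From mathcomp Require Import spectral measurable_realfun ring lra.
Import Order.TTheory GRing.Theory Num.Theory.
Import numFieldNormedType.Exports.
Local Open Scope classical_set_scope.
Local Open Scope ring_scope.
Local Open Scope complex_scope.

(** Put [s_j = - xi_j], so that the [s_j] lie in [Sigma], and
    [B(z) = prod_j (z - s_j) / (z + s_j)], so that [B = r_Xi]. Interpolating [f] at
    the [s_j] by [p / q_k] leaves the error [r_Xi(x) * N_x(f)], where [N_x] is a
    linear functional of [f] ([scaled_error]); it commutes with the integral
    representation of [f], so only kernels matter.

    For the kernel [1 / (z + x)] one finds [N_x = B(z) / (z + x)] and [|B| <= 1]; this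
    settles Cauchy-Stieltjes functions, and complete Bernstein functions are [x] times
    such functions.

    For [e^(- t x)], [N_x] is, as a function [y_x] of [t], the inverse Laplace transform
    of [B(z) / (z + x)]: the output of a chain of all-pass filters [(z - s_j) / (z + s_j)]
    fed with [e^(- x t)]. Such filters preserve the L2 norm, here [1 / sqrt (2 x)], and
    Cauchy-Schwarz gives [|y_x| <= 1 + sum_j sqrt (s_j / x)] and
    [|y_x - y_x'| <= (x' - x) / (2 sqrt (x x'))]. Hence [|y_x| <= 2] for
    [x >= k^2 lambda_max], and going up there from [x] in [Sigma] by steps of ratio
    between 4 and 5, each costing at most 1, yields a bound logarithmic in
    [k^2 lambda_max / lambda_min], which is below [4 gamma_k].

    When [L] is self-adjoint, quasi-optimality with constant 1 holds because the
    approximation is exact on [P_k / q_k] and because, with [P = V V^+] the orthogonal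
    projection onto the Krylov space, [V p(L_{k+1}) V^+ = p(P L P) P] for polynomials [p],
    where [P L P] is Hermitian. *)

(** * Rational interpolation at nodes [s] with poles at their negatives *)

Section Interpolation.
Context {F : fieldType}.
Implicit Types (s : seq F) (g : F -> F).

(* Minus the residue at [- a] of the product of the [(z - c) / (z + c)], [c] in [s]. *)
Definition residue s a : F := 2 * a * \prod_(c <- s | c != a) ((a + c) / (a - c)).

(** Lagrange form: for distinct nodes, [residue s a * \prod_(c <- s | c != a) (x - c)] equals the
    denominator at [x = a] and vanishes at the other nodes, so the subtracted fraction takes the
    value [g a] at [a]. *)
Definition interp_error s g x : F :=
  g x - (\sum_(a <- s) g a * residue s a * \prod_(c <- s | c != a) (x - c))
        / \prod_(a <- s) (x + a).

Definition scaled_error s g x : F :=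
  \prod_(a <- s) ((x + a) / (x - a)) * g x - \sum_(a <- s) residue s a / (x - a) * g a.

Lemma residue_cons s m a : m != a -> residue (m :: s) a = (a + m) / (a - m) * residue s a.
Proof. by move=> ma; rewrite /residue big_cons ma; ring. Qed.

Lemma residue_head s m : m \notin s ->
  residue (m :: s) m = 2 * m * \prod_(c <- s) ((m + c) / (m - c)).
Proof.
move=> ms; rewrite /residue big_cons eqxx /=; congr (_ * _).
rewrite big_seq_cond [RHS]big_seq; apply: eq_bigl => c.
by case: (boolP (c \in s)) => //= cs; apply: contraNneq ms => <-.
Qed.

(** Induction on [s]. The residue at the new node [m] contains the product of the old factors at
    [- m], so the induction hypothesis is applied both at [z] and at [- m]. *)
Lemma partial_fraction s z : uniq s -> (forall a, a \in s -> z + a != 0) ->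
  \prod_(a <- s) ((z - a) / (z + a)) = 1 - \sum_(a <- s) residue s a / (z + a).
Proof.
elim: s z => [|m s IH] z /= => [_ _|/andP[ms us] zs]; first by rewrite !big_nil subr0.
have zm : z + m != 0 by apply: zs; rewrite mem_head.
have zs' a : a \in s -> z + a != 0 by move=> ?; apply: zs; rewrite inE orbC; apply/orP; left.
have ne a : a \in s -> m != a by move=> ?; apply: contraNneq ms => ->.
rewrite !big_cons residue_head // IH //.
have -> : \prod_(c <- s) ((m + c) / (m - c)) = \prod_(c <- s) ((- m - c) / (- m + c)).
  by apply: eq_bigr => c _; rewrite -opprD (addrC (- m)) -(opprB m c) invrN mulrNN.
rewrite IH //; last by move=> a /ne; rewrite addrC subr_eq0 eq_sym.
set S1 := \sum_(a <- s) _; set S2 := \sum_(a <- s) _.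
have -> : \sum_(a <- s) residue (m :: s) a / (z + a)
    = (z - m) / (z + m) * S1 + 2 * m / (z + m) * S2.
  rewrite !mulr_sumr -big_split; apply: eq_big_seq => a as_ /=.
  rewrite residue_cons ?ne //.
  have := zs' _ as_; have := ne _ as_; rewrite eq_sym -subr_eq0 => am za.
  by field; rewrite zm za addrC am.
by field.
Qed.

Lemma interp_errorE s g x : uniq s -> x \notin s -> (forall a, a \in s -> x + a != 0) ->
  interp_error s g x = \prod_(a <- s) ((x - a) / (x + a)) * scaled_error s g x.
Proof.
move=> us xs xa; rewrite /interp_error /scaled_error.
have d0 : \prod_(a <- s) (x - a) != 0.
  rewrite prodf_seq_neq0; apply/allP => a as_ /=; apply: contraNneq xs => /eqP.
  by rewrite subr_eq0 => /eqP ->.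
have n0 : \prod_(a <- s) (x + a) != 0.
  by rewrite prodf_seq_neq0; apply/allP => a as_ /=; exact: xa.
rewrite !prodf_div mulrBr mulr_sumr; congr (_ - _); first by field; rewrite n0 d0.
rewrite mulr_suml; apply: eq_big_seq => a as_.
rewrite [in RHS](bigD1_seq a) //=.
have xa0 : x - a != 0 by rewrite subr_eq0; apply: contraNneq xs => ->.
by field; rewrite xa0 n0.
Qed.

(** At a node the formula through [scaled_error] would divide by zero, so nodes are treated
    directly: only the term of [x] survives in the sum, and it cancels [g x]. *)
Lemma interp_error_node s g x : uniq s -> x \in s ->
  (forall a, a \in s -> x + a != 0) -> interp_error s g x = 0.
Proof.
move=> us xs xa; rewrite /interp_error (bigD1_seq x) //= [X in (_ + X) / _]big1_seq ?addr0; last first.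
  move=> a /andP[ax as_]; apply/eqP; rewrite mulf_eq0; apply/orP; right.
  rewrite prodf_seq_eq0; apply/hasP; exists x => //=.
  by rewrite eq_sym ax subrr /=.
have h : \prod_(c <- s | c != x) (x - c) != 0.
  rewrite prodf_seq_neq0; apply/allP => c cs /=; apply/implyP.
  by rewrite eq_sym subr_eq0.
have n0 : \prod_(a <- s | a != x) (x + a) != 0.
  rewrite prodf_seq_neq0; apply/allP => a as_ /=; apply/implyP => _; exact: xa.
rewrite /residue [X in _ / X](bigD1_seq x) //= prodf_div.
have x2 : x + x != 0 by exact: xa.
apply/eqP; rewrite subr_eq0; apply/eqP; field.
by rewrite n0 x2 h.
Qed.

(** Partial fractions at [z = - x], where each factor [(z - a) / (z + a)] becomes
    [(x + a) / (x - a)]. *)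
Lemma scaled_error1 s x : uniq s -> x \notin s -> scaled_error s (fun=> 1) x = 1.
Proof.
move=> us xs; rewrite /scaled_error mulr1.
have -> : \prod_(a <- s) ((x + a) / (x - a)) = \prod_(a <- s) ((- x - a) / (- x + a)).
  by apply: eq_bigr => a _; rewrite -opprD (addrC (- x)) -(opprB x a) invrN mulrNN.
rewrite partial_fraction //; last first.
  by move=> a as_; rewrite addrC subr_eq0; apply: contraNneq xs => <-.
rewrite -addrA -opprD -big_split big1_seq ?subr0//= => a _.
by rewrite /= mulr1 (addrC (- x)) -(opprB x a) invrN mulrN addNr.
Qed.

(** As [1 / ((x - a) (z + a)) = (1 / (x - a) + 1 / (z + a)) / (z + x)], the sum separates into those
    of [scaled_error1] and [partial_fraction]. *)
Lemma scaled_error_resolvent s z x : uniq s -> x \notin s -> z + x != 0 ->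
    (forall a, a \in s -> z + a != 0) ->
  scaled_error s (fun x => (z + x)^-1) x = \prod_(a <- s) ((z - a) / (z + a)) / (z + x).
Proof.
move=> us xs zx za; rewrite partial_fraction //.
have /eqP := scaled_error1 _ _ us xs; rewrite /scaled_error mulr1 subr_eq => /eqP ->.
rewrite mulrDl mulrBl -addrA; congr (_ + _).
rewrite !mulr_suml -sumrB -sumrN; apply: eq_big_seq => a as_.
have xa : x - a != 0 by rewrite subr_eq0; apply: contraNneq xs => ->.
by have := za _ as_ => h1; field; rewrite h1 xa zx.
Qed.

End Interpolation.

(** * Energy of all-pass filters and bounds for the exponential kernel *)

Section Energy.
Context {R : realType}.
Implicit Types (s : seq R) (u w : R -> R) (c a m x t : R).

(* [P] is a Lyapunov function: it witnesses, without integrals, that the energy of [u]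
   on the half-line is at most [c]. *)
Definition energy_le c u := exists P P' : R -> R,
  [/\ forall t, 0 <= P t, P 0 <= c, forall t, is_derive t 1 P (P' t)
    & forall t, P' t <= - u t ^+ 2].

Lemma is_derive_nincr (P P' : R -> R) t : (forall t, is_derive t 1 P (P' t)) ->
  (forall t, P' t <= 0) -> 0 <= t -> P t <= P 0.
Proof.
move=> dP leP' t0; apply: (@ler0_derive1_nincr _ P 0 t) => //.
- by move=> y _; have h := dP y; rewrite derive1E derive_val; exact: leP'.
- by apply: derivable_within_continuous => y _; case: (dP y).
Qed.

(** Here [w] is the state of the filter with pole [- a], input [u] and output [u - 2 a w]. Adding
    [2 a w^2] to the Lyapunov function of the input gives one for the output, as [- u^2 + 4 a w (u -
    a w) = - (u - 2 a w)^2]; its decrease also bounds the state pointwise. *)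
Lemma energy_allpass c u w a : 0 < a -> energy_le c u -> w 0 = 0 ->
    (forall t, is_derive t 1 w (- a * w t + u t)) ->
  energy_le c (fun t => u t - 2 * a * w t) /\
  forall t, 0 <= t -> 2 * a * w t ^+ 2 <= c.
Proof.
move=> a0 [P [P' [P0 Pc dP leP']]] w0 dw.
pose Q t := P t + 2 * a * w t ^+ 2.
pose Q' t := P' t + 4 * a * w t * (- a * w t + u t).
have dQ t : is_derive t 1 Q (Q' t).
  have d1 := dP t; have d2 := dw t; rewrite /Q /Q'.
  apply: is_derive_eq.
  by rewrite /GRing.scale /=; ring.
have leQ' t : Q' t <= - (u t - 2 * a * w t) ^+ 2.
  by have := leP' t; rewrite /Q'; nra.
have Q0 : Q 0 <= c by rewrite /Q w0 expr0n mulr0 addr0.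
split.
  exists Q, Q'; split => // t.
  by rewrite addr_ge0// mulr_ge0 ?sqr_ge0// mulr_ge0// ltW.
move=> t t0; apply: le_trans Q0.
apply: (@le_trans _ _ (Q t)); first by rewrite lerDr.
apply: is_derive_nincr t0 => // y.
by apply: le_trans (leQ' y) _; rewrite oppr_le0 sqr_ge0.
Qed.

Lemma is_derive_expRM a t : is_derive t 1 (fun t => expR (- a * t)) (- a * expR (- a * t)).
Proof. by apply: is_derive_eq; rewrite /GRing.scale /=; ring. Qed.

Lemma energy_exp x : 0 < x -> energy_le (2 * x)^-1 (fun t => expR (- x * t)).
Proof.
move=> x0; exists (fun t => expR (- x * t) ^+ 2 / (2 * x)), (fun t => - expR (- x * t) ^+ 2).
split=> [t||t|t //].
- by rewrite divr_ge0 ?sqr_ge0// mulr_ge0// ltW.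
- by rewrite mulr0 expR0 expr1n mul1r.
- have d := is_derive_expRM x t; apply: is_derive_eq.
  by rewrite /GRing.scale /=; field; rewrite gt_eqF.
Qed.

Lemma is_derive_expsum s (g : R -> R) t :
  is_derive t 1 (fun t => \sum_(a <- s) g a * expR (- a * t))
    (\sum_(a <- s) g a * (- a * expR (- a * t))).
Proof.
elim: s => [|m s IH].
  by rewrite big_nil; under eq_fun do rewrite big_nil; exact: is_derive_cst.
rewrite big_cons; under eq_fun do rewrite big_cons.
have d := is_derive_expRM m t.
by apply: is_derive_eq; rewrite /GRing.scale /=; ring.
Qed.

Definition exp_error s x t := scaled_error s (fun y => expR (- y * t)) x.

Lemma is_derive_exp_error s x t :
  is_derive t 1 (exp_error s x)
    (\prod_(a <- s) ((x + a) / (x - a)) * (- x * expR (- x * t))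
     - \sum_(a <- s) residue s a / (x - a) * (- a * expR (- a * t))).
Proof.
have d1 := is_derive_expRM x t.
have d2 := is_derive_expsum s (fun a => residue s a / (x - a)) t.
rewrite /exp_error /scaled_error.
by apply: is_derive_eq; rewrite /GRing.scale /=; ring.
Qed.

(** The initial value is the same for all [s] and [x], so the states below, being differences, start
    at 0. *)
Lemma exp_error0 s x : uniq s -> x \notin s -> exp_error s x 0 = 1.
Proof.
move=> us xs; rewrite -[RHS](scaled_error1 s x) //; rewrite /exp_error.
by congr scaled_error; apply/funext => y; rewrite mulr0 expR0.
Qed.

(** Since [(z - m) / (z + m) = 1 - 2 m / (z + m)], this is the state of the filter for [m] fed with
    [exp_error s x]. *)
Definition allpass_state s m x t := (exp_error s x t - exp_error (m :: s) x t) / (2 * m).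

Lemma is_derive_allpass_state s m x t : 0 < m -> uniq (m :: s) -> x \notin m :: s ->
  is_derive t 1 (allpass_state s m x) (- m * allpass_state s m x t + exp_error s x t).
Proof.
move=> m0 ums xms.
have d1 := is_derive_exp_error s x t.
have d2 := is_derive_exp_error (m :: s) x t.
rewrite /allpass_state; apply: is_derive_eq.
have sums : \sum_(a <- s) residue (m :: s) a / (x - a) * (- a * expR (- a * t)) =
    - m * (\sum_(a <- s) residue (m :: s) a / (x - a) * expR (- a * t))
    - m * (\sum_(a <- s) residue s a / (x - a) * expR (- a * t))
    + \sum_(a <- s) residue s a / (x - a) * (- a * expR (- a * t)).
  rewrite !mulr_sumr -sumrB -big_split; apply: eq_big_seq => a as_ /=.
  have am : a - m != 0.
    by rewrite subr_eq0; apply: contraTneq ums => <- /=; rewrite as_.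
  rewrite residue_cons; last by rewrite eq_sym -subr_eq0.
  have xa : x - a != 0.
    by rewrite subr_eq0; apply: contraNneq xms => ->; rewrite inE as_ orbT.
  by field; rewrite am xa.
have xm : x - m != 0.
  by rewrite subr_eq0; apply: contraNneq xms => ->; rewrite mem_head.
rewrite /GRing.scale /exp_error /scaled_error /= !big_cons sums.
by field; rewrite xm gt_eqF.
Qed.

(** The Laplace transform is [B(z) / ((z + x1) (z + x2))]: the state of a filter with pole [- x2]
    fed with [exp_error s x1]. *)
Definition exp_resolvent s x1 x2 t := (exp_error s x1 t - exp_error s x2 t) / (x2 - x1).

Lemma is_derive_exp_resolvent s x1 x2 t : x1 != x2 -> x1 \notin s -> x2 \notin s ->
  is_derive t 1 (exp_resolvent s x1 x2) (- x2 * exp_resolvent s x1 x2 t + exp_error s x1 t).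
Proof.
move=> x12 x1s x2s.
have d1 := is_derive_exp_error s x1 t.
have d2 := is_derive_exp_error s x2 t.
rewrite /exp_resolvent; apply: is_derive_eq.
have sums : \sum_(a <- s) residue s a / (x1 - a) * (- a * expR (- a * t)) =
    - x2 * (\sum_(a <- s) residue s a / (x1 - a) * expR (- a * t))
    + x2 * (\sum_(a <- s) residue s a / (x2 - a) * expR (- a * t))
    + (x2 - x1) * (\sum_(a <- s) residue s a / (x1 - a) * expR (- a * t))
    + \sum_(a <- s) residue s a / (x2 - a) * (- a * expR (- a * t)).
  rewrite !mulr_sumr -!big_split; apply: eq_big_seq => a as_ /=.
  have xa1 : x1 - a != 0 by rewrite subr_eq0; apply: contraNneq x1s => ->.
  have xa2 : x2 - a != 0 by rewrite subr_eq0; apply: contraNneq x2s => ->.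
  by field; rewrite xa1 xa2.
rewrite /GRing.scale /exp_error /scaled_error /= sums.
by field; rewrite subr_eq0 eq_sym.
Qed.

(** Each filter passes on the energy bound [1 / (2 x)]. Its state satisfies [2 m w^2 <= 1 / (2 x)],
    so it changes the signal by [2 m w], at most [sqrt (m / x)] in modulus. *)
Lemma exp_error_energy s x : 0 < x -> uniq s -> x \notin s -> {in s, forall a, 0 < a} ->
  energy_le (2 * x)^-1 (exp_error s x) /\
  forall t, 0 <= t -> `|exp_error s x t| <= 1 + \sum_(a <- s) Num.sqrt (a / x).
Proof.
move=> x0; elim: s => [|m s IH].
  move=> _ _ _; have -> : exp_error [::] x = fun t => expR (- x * t).
    by apply/funext => t; rewrite /exp_error /scaled_error !big_nil mul1r subr0.
  split; first exact: energy_exp.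
  move=> t t0; rewrite big_nil addr0 ger0_norm ?expR_ge0// -expR0 ler_expR.
  by rewrite mulNr oppr_le0 mulr_ge0// ltW.
move=> ums xms s0.
have m0 : 0 < m by apply: s0; rewrite mem_head.
have /andP[_ us] := ums.
have /[!inE] /norP[_ xs] := xms.
have [|Es Bs] := IH us xs; first by move=> a as_; apply: s0; rewrite inE as_ orbT.
have w0 : allpass_state s m x 0 = 0.
  by rewrite /allpass_state !exp_error0 // subrr mul0r.
have [Em Bm] := energy_allpass _ _ _ _ m0 Es w0
  (fun t => is_derive_allpass_state s m x t m0 ums xms).
have E t : exp_error (m :: s) x t = exp_error s x t - 2 * m * allpass_state s m x t.
  by rewrite /allpass_state; field; rewrite gt_eqF.
split; first by rewrite (funext E).
move=> t t0; rewrite E big_cons addrCA [leRHS]addrC. apply: le_trans (ler_normB _ _) _.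
rewrite lerD ?Bs//.
rewrite -sqrtr_sqr ler_wsqrtr //.
have := Bm t t0; rewrite -(ler_pM2l (_ : 0 < 2 * m)) ?mulr_gt0// => h.
rewrite exprMn expr2 -!mulrA; apply: le_trans (_ : 2 * m / (2 * x) <= _).
  by move: h; rewrite -!mulrA.
by rewrite le_eqVlt; apply/orP; left; apply/eqP; field; rewrite gt_eqF.
Qed.

(** The difference is [(x2 - x1) w] with [w] the state [exp_resolvent], and
    [2 x2 w^2 <= 1 / (2 x1)]. *)
Lemma exp_error_step s x1 x2 t : 0 < x1 -> x1 < x2 -> uniq s -> x1 \notin s -> x2 \notin s ->
  {in s, forall a, 0 < a} -> 0 <= t ->
  `|exp_error s x1 t - exp_error s x2 t| <= (x2 - x1) / (2 * Num.sqrt (x1 * x2)).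
Proof.
move=> x10 x12 us x1s x2s s0 t0; have x20 := lt_trans x10 x12.
have [E _] := exp_error_energy _ _ x10 us x1s s0.
have w0 : exp_resolvent s x1 x2 0 = 0.
  by rewrite /exp_resolvent !exp_error0 // subrr mul0r.
have [_ /(_ _ t0) B] := energy_allpass _ _ _ _ x20 E w0
  (fun t => is_derive_exp_resolvent s x1 x2 t (negbT (lt_eqF x12)) x1s x2s).
have -> : exp_error s x1 t - exp_error s x2 t = (x2 - x1) * exp_resolvent s x1 x2 t.
  by rewrite /exp_resolvent; field; rewrite subr_eq0 gt_eqF.
rewrite normrM ger0_norm ?subr_ge0 ?(ltW x12)//.
rewrite ler_wpM2l ?subr_ge0 ?(ltW x12)//.
have p0 : 0 < Num.sqrt (x1 * x2) by rewrite sqrtr_gt0 mulr_gt0.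
rewrite -(ler_pXn2r (_ : (0 < 2)%N)) ?nnegrE ?invr_ge0 ?mulr_ge0 ?(ltW p0)//.
move: (exp_resolvent s x1 x2 t) B => w B.
rewrite real_normK ?num_real// exprVn exprMn sqr_sqrtr ?mulr_ge0 ?(ltW x10) ?(ltW x20)//.
rewrite (_ : _^-1 = (2 * x1)^-1 / (2 * x2)); last by field; rewrite !gt_eqF.
by rewrite ler_pdivlMr ?mulr_gt0// mulrC.
Qed.

Lemma notin_seq_itv s (l u : R) : l < u -> exists2 x, x \notin s & l < x < u.
Proof.
elim: s l u => [|m s IH] l u lu; first by exists ((l + u) / 2) => //; lra.
have [x xs /andP[lx xu]] := IH l u lu.
have [xm|mx|xm] := ltgtP x m.
- by exists x; rewrite ?inE ?(lt_eqF xm)// lx xu.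
- by exists x; rewrite ?inE ?(gt_eqF mx)// lx xu.
have [y ys /andP[ly yx]] := IH l x lx.
by exists y; rewrite ?inE -?xm ?(lt_eqF yx)// ly (lt_trans yx xu).
Qed.

Lemma exp_error_dyadic (s : seq R) (b t : R) : uniq s -> {in s, forall a, 0 < a <= b} -> 0 <= t ->
  forall N x, 0 < x -> x \notin s -> (size s)%:R ^+ 2 * b <= 4 ^+ N * x ->
  `|exp_error s x t| <= 2 + N%:R.
Proof.
move=> us sb t0; have s0 : {in s, forall a, 0 < a} by move=> a /sb /andP[].
elim=> [|N IH] x x0 xs; last first.
  move=> h.
  (* A ratio of at least 4 serves the induction hypothesis, and a step costs at most 1 for ratios up
     to [3 + 2 sqrt 2], which exceeds 5. The open interval leaves room to avoid the nodes. *)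
  have [|y ys /andP[xy yx]] := notin_seq_itv s (4 * x) (5 * x); first by lra.
  have y0 : 0 < y by lra.
  have x1 : x < y by lra.
  have := exp_error_step s x y t x0 x1 us xs ys s0 t0.
  have := IH y y0 ys.
  have -> : (size s)%:R ^+ 2 * b <= 4 ^+ N * y.
    by apply: (le_trans h); rewrite exprSr -mulrA ler_wpM2l ?exprn_ge0// ltW.
  move=> /(_ isT) h1 h2.
  have p0 : 0 < Num.sqrt (x * y) by rewrite sqrtr_gt0 mulr_gt0.
  have h3 : (y - x) / (2 * Num.sqrt (x * y)) <= 1.
    rewrite ler_pdivrMr ?mulr_gt0// mul1r.
    rewrite -(ler_pXn2r (_ : (0 < 2)%N)) ?nnegrE ?subr_ge0 ?(ltW x1) ?mulr_ge0 ?(ltW p0)//.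
    rewrite exprMn sqr_sqrtr ?mulr_ge0 ?(ltW x0) ?(ltW y0)//; nra.
  have := ler_normD (exp_error s x t - exp_error s y t) (exp_error s y t).
  rewrite subrK -natr1; lra.
rewrite expr0 mul1r addr0 => h.
have [_ /(_ t t0) B] := exp_error_energy _ _ x0 us xs s0.
apply: le_trans B _; rewrite -[X in _ <= X]/(1 + 1) lerD2l.
have [->|/negP sn] := eqVneq s [::]; first by rewrite big_nil.
have k0 : 0 < (size s)%:R :> R by rewrite ltr0n lt0n size_eq0; exact/negP.
(* Now [x >= k^2 b] with [k = size s], so each of the [k] terms [sqrt (a / x)] is at most
   [1 / k]. *)
apply: (@le_trans _ _ (\sum_(a <- s) (size s)%:R^-1)); last first.
  by rewrite big_const_seq count_predT iter_addr_0 -[leLHS]mulr_natr mulVf // gt_eqF.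
rewrite big_seq [leRHS]big_seq; apply: ler_sum => a /sb /andP[a0 ab].
rewrite -[leRHS]ger0_norm ?invr_ge0 ?(ltW k0)// -sqrtr_sqr ler_wsqrtr //.
rewrite ler_pdivrMr// exprVn mulrC ler_pdivlMr ?exprn_gt0//.
apply: le_trans h; by rewrite mulrC ler_wpM2l ?exprn_ge0// ltW.
Qed.

End Energy.

(** * Comparison of the number of steps with [gamma] *)

Section Gamma.
Context {R : realType}.

Lemma pi_le4 : pi <= 4 :> R.
Proof. by have [/andP[_ h] _] := @pihalf_02_cos_pihalf R; lra. Qed.

Lemma ln4_ge1 : 1 <= ln 4 :> R.
Proof.
have := @le_ln1Dx R (- 2^-1) _; have -> : 1 - 2^-1 = 2^-1 :> R by lra.
have -> : 4 = 2 * 2 :> R by lra.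
rewrite lnV ?posrE// lnM ?posrE// => h; have := h _; lra.
Qed.

(** Take the least such [N]. With [w] the argument of the logarithm in [gamma], [pi <= 4] gives
    [4 k^2 lmax <= w^2 lmin], so minimality yields [4^(N - 1) <= w^2], and [N - 1 <= 2 ln w] as
    [ln 4 >= 1]. Finally [2 <= 8 / pi] and [3 <= 892 / 100]. *)
Lemma dyadic_gamma (lmin lmax x : R) (k : nat) : (0 < k)%N -> 0 < lmin -> lmin <= lmax ->
  lmin <= x ->
  exists2 N, k%:R ^+ 2 * lmax <= 4 ^+ N * x & 2 + N%:R <= 4 * gamma lmin lmax k.
Proof.
move=> k0 l0 lm lx; have x0 : 0 < x by apply: lt_le_trans lx.
have m0 : 0 < lmax by apply: lt_le_trans lm.
have kR : 1 <= k%:R :> R by rewrite ler1n.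
have p0 := @pi_gt0 R; have p4 := pi_le4.
rewrite /gamma; move: (@pi R) p0 p4 => q p0 p4; set w := 4 * k%:R * _.
have w0 : 0 < w by rewrite !mulr_gt0 ?ltr0n// sqrtr_gt0 divr_gt0// mulr_gt0.
have ww : 4 * (k%:R ^+ 2 * lmax) <= w ^+ 2 * lmin.
  rewrite !exprMn sqr_sqrtr; last by rewrite divr_ge0 ?mulr_ge0// ltW.
  rewrite (_ : _ * lmin = 16 / q * (k%:R ^+ 2 * lmax)); last first.
    by field; rewrite !gt_eqF.
  rewrite ler_wpM2r ?mulr_ge0 ?(ltW m0)// ler_pdivlMr//; lra.
clearbody w; have w1 : 0 <= ln w.
  apply: ln_ge0; rewrite -(ler_pXn2r (_ : (0 < 2)%N)) ?nnegrE ?(ltW w0)// expr1n.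
  rewrite -(ler_pM2r l0) mul1r; apply: le_trans ww.
  have : lmax <= k%:R ^+ 2 * lmax by rewrite ler_peMl ?(ltW m0)// exprn_ege1.
  lra.
have p2 : 2 * ln w <= 8 / q * ln w by rewrite ler_wpM2r// ler_pdivlMr//; lra.
have ex : exists N, k%:R ^+ 2 * lmax <= 4 ^+ N * x.
  exists (Num.truncn (k%:R ^+ 2 * lmax / x)).+1; rewrite -ler_pdivrMr//.
  apply: le_trans (ltW (truncnS_gt _)) _.
  by rewrite -[4 ^+ _]natrX ler_nat ltnW// ltn_expl.
case: (ex_minnP ex) => N hN minN; exists N => //.
have -> : 4 * (223 / 100 + 2 / q * ln w) = 892 / 100 + 8 / q * ln w by lra.
case: N hN minN => [|N] hN minN.
  by move: p2 w1; move: (8 / q * ln w) (ln w) => z1 z2; lra.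
have lt : 4 ^+ N * x < k%:R ^+ 2 * lmax.
  by rewrite ltNge; apply/negP => /minN; rewrite ltnn.
have le : 4 ^+ N <= w ^+ 2.
  rewrite -(ler_pM2r l0); apply: le_trans (_ : 4 ^+ N * x <= _).
    by rewrite ler_wpM2l// exprn_ge0.
  apply: le_trans (ltW lt) (le_trans _ ww).
  rewrite ler_peMl //; last lra.
  by rewrite mulr_ge0 ?sqr_ge0// ltW.
have : ln (4 ^+ N) <= ln (w ^+ 2) :> R by rewrite ler_ln ?posrE ?exprn_gt0.
rewrite !lnXn// -[leLHS]mulr_natl -[leRHS]mulr_natl -[N.+1%:R]natr1.
have : N%:R <= N%:R * ln 4 :> R by rewrite ler_peMr ?ln4_ge1.
move: p2; set z1 := 8 / q * ln w; set z2 := ln w; set z3 := _ * ln 4; clearbody z1 z2 z3; lra.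
Qed.

Lemma exp_error_gamma (s : seq R) (lmin lmax x t : R) : (0 < size s)%N -> uniq s ->
    0 < lmin -> {in s, forall a, lmin <= a <= lmax} -> lmin <= x <= lmax -> x \notin s ->
    0 <= t ->
  `|exp_error s x t| <= 4 * gamma lmin lmax (size s).
Proof.
move=> s0 us l0 sl /andP[lx xm] xs t0.
have lm := le_trans lx xm.
have [N hN le] := dyadic_gamma lmin lmax x (size s) s0 l0 lm lx.
apply: le_trans le; apply: exp_error_dyadic hN => //; last exact: lt_le_trans lx.
by move=> a /sl /andP[la ->]; rewrite (lt_le_trans l0 la).
Qed.

End Gamma.

(** * Integral representations and interpolation errors of the function classes *)

Section Stieltjes.
Context {R : realType}.
Implicit Types (s : seq R) (x : R).

(** Convergence is bundled with a finite value, so that linear combinations can be formed in [R]. *)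
Definition has_integral (mu : {measure set (measurableTypeR R) -> \bar R}) (D : set R)
    (g : R -> R) (v : R) :=
  mu.-integrable D (fun z => (g z)%:E) /\ v%:E = (\int[mu]_(z in D) (g z)%:E)%E.

Section HasIntegral.
Variables (mu : {measure set (measurableTypeR R) -> \bar R}) (D : set R).
Hypothesis mD : measurable (D : set (measurableTypeR R)).

Lemma has_integralB g1 g2 v1 v2 : has_integral mu D g1 v1 -> has_integral mu D g2 v2 ->
  has_integral mu D (fun z => g1 z - g2 z) (v1 - v2).
Proof.
move=> [i1 e1] [i2 e2]; split.
  by have := integrableB mD i1 i2; apply: eq_integrable => // z _; rewrite EFinB.
by rewrite EFinB e1 e2 -integralB_EFin //; apply: eq_integral => z _; rewrite EFinB.
Qed.

Lemma has_integralZ c g v : has_integral mu D g v ->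
  has_integral mu D (fun z => c * g z) (c * v).
Proof.
move=> [i e]; split.
  by have := integrableZl mD c i; apply: eq_integrable => // z _; rewrite EFinM.
by rewrite EFinM e -integralZl //; apply: eq_integral => z _; rewrite EFinM.
Qed.

Lemma has_integral_sum s (g : R -> R -> R) v : {in s, forall a, has_integral mu D (g a) (v a)} ->
  has_integral mu D (fun z => \sum_(a <- s) g a z) (\sum_(a <- s) v a).
Proof.
elim: s => [_|m s IH h].
  rewrite big_nil; under eq_fun do rewrite big_nil.
  by split; [exact: integrable0 | rewrite integral0].
have Hm : has_integral mu D (fun z => 0 - g m z) (0 - v m).
  apply: has_integralB; last by apply: h; rewrite mem_head.
  by split; [exact: integrable0 | rewrite integral0].
have Hs := IH (fun a as_ => h a (@mem_behead _ (m :: s) a as_)).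
have := has_integralB _ _ _ _ Hs Hm; rewrite sub0r opprK addrC big_cons.
by congr has_integral; apply/funext => z; rewrite sub0r opprK addrC big_cons.
Qed.

Lemma has_integral_scaled_error s (k : R -> R -> R) (f : R -> R) x :
    (forall y, 0 < y -> has_integral mu D (k^~ y) (f y)) ->
    {in s, forall a, 0 < a} -> 0 < x ->
  has_integral mu D (fun z => scaled_error s (k z) x) (scaled_error s f x).
Proof.
move=> kf s0 x0; apply: has_integralB; first exact/has_integralZ/kf.
by apply: has_integral_sum => a /s0 a0; exact/has_integralZ/kf.
Qed.

Lemma has_integral_le g1 g2 v1 v2 : has_integral mu D g1 v1 -> has_integral mu D g2 v2 ->
  (forall z, D z -> g1 z <= g2 z) -> v1 <= v2.
Proof.
move=> [i1 e1] [i2 e2] le; rewrite -lee_fin e1 e2; apply: le_integral => // z.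
by rewrite inE lee_fin => /le.
Qed.

(** The majorant may have an infinite integral, since the measure of a Laplace-Stieltjes function
    may have infinite mass. *)
Lemma has_integral_norm_le g v (M : measurableTypeR R -> \bar R) : has_integral mu D g v ->
    measurable_fun (D : set (measurableTypeR R)) M -> (forall z, D z -> (`|g z|%:E <= M z)%E) ->
  (`|v|%:E <= \int[mu]_(z in D) M z)%E.
Proof.
move=> [i e] mM le; rewrite -abse_EFin e.
have mg := measurable_int mu i.
apply: le_trans (le_abse_integral mu mD mg) _.
by apply: ge0_le_integral => //; exact: measurableT_comp.
Qed.

End HasIntegral.

(** The numerator has degree below [size s], one less than the Krylov space admits; this leaves room
    for the factor [x] in the complete Bernstein case. *)
Lemma interp_errorP s (f : R -> R) : {p : {poly R} | (size p <= size s)%N &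
  forall x, interp_error s f x = f x - p.[x] / \prod_(a <- s) (x + a)}.
Proof.
exists (\sum_(a <- s) (f a * residue s a) *: \prod_(c <- s | c != a) ('X - c%:P)).
  apply: leq_trans (size_sum _ _ _) _; apply/bigmax_leqP_seq => a as_ _.
  apply: leq_trans (size_scale_leq _ _) _.
  rewrite -big_filter size_prod_XsubC size_filter -(count_predC (pred1 a)) -add1n leq_add2r.
  by rewrite -has_count has_pred1.
move=> x; rewrite /interp_error; congr (_ - _ / _).
rewrite horner_sum; apply: eq_bigr => a _; rewrite hornerZ; congr (_ * _).
by rewrite horner_prod; apply: eq_bigr => c _; rewrite hornerXsubC.
Qed.

Definition cauchy_transform (w f : R -> R) := forall x, 0 < x ->
  has_integral lebesgue_measure `]0, +oo[ (fun z => w z / (z + x)) (f x).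

Lemma normr_blaschke_le1 s (z : R) : 0 < z -> {in s, forall a, 0 < a} ->
  `|\prod_(a <- s) ((z - a) / (z + a))| <= 1.
Proof.
move=> z0 s0; rewrite normr_prod; elim: s s0 => [_|m s IH s0]; first by rewrite big_nil.
rewrite big_cons mulr_ile1 ?prodr_ge0//; last first.
  by apply: IH => a as_; apply: s0; rewrite inE as_ orbT.
have m0 : 0 < m by apply: s0; rewrite mem_head.
rewrite normrM normfV (ger0_norm (ltW (addr_gt0 z0 m0))) ler_pdivrMr ?addr_gt0//.
by rewrite mul1r ler_norml; apply/andP; split; lra.
Qed.

Lemma cauchy_transform_scaled_error w f s x : density w -> cauchy_transform w f ->
    uniq s -> {in s, forall a, 0 < a} -> 0 < x -> x \notin s ->
  `|scaled_error s f x| <= f x.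
Proof.
move=> [mw w0] wf us s0 x0 xs.
have H := has_integral_scaled_error _ _ (measurable_itv _) s _ f x wf s0 x0.
have [I E] := wf x x0.
rewrite -lee_fin E; apply: has_integral_norm_le H _ _ => //; first exact: measurable_int I.
move=> z /=; rewrite in_itv /= andbT => z0; rewrite lee_fin.
have -> : scaled_error s (fun x => w z / (z + x)) x =
    w z * scaled_error s (fun x => (z + x)^-1) x.
  rewrite /scaled_error mulrBr mulr_sumr; congr (_ - _); first by ring.
  by apply: eq_bigr => a _; ring.
rewrite scaled_error_resolvent //; last 2 first.
- by rewrite gt_eqF// addr_gt0.
- by move=> a /s0 a0; rewrite gt_eqF// addr_gt0.
rewrite !normrM ger0_norm ?w0// ler_wpM2l ?w0//.
rewrite normfV (ger0_norm (ltW (addr_gt0 z0 x0))) ler_piMl ?invr_ge0 ?(ltW (addr_gt0 z0 x0))//.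
exact: normr_blaschke_le1.
Qed.

Lemma cauchy_transform_ge0 w f x : density w -> cauchy_transform w f -> 0 < x -> 0 <= f x.
Proof.
move=> [mw w0] wf x0; rewrite -lee_fin (wf x x0).2; apply: integral_ge0 => z /=.
rewrite in_itv /= andbT => z0; rewrite lee_fin divr_ge0 ?w0// ltW// addr_gt0//.
Qed.

Lemma cauchy_transform_nincr w f x y : density w -> cauchy_transform w f -> 0 < x -> x <= y ->
  f y <= f x.
Proof.
move=> [mw w0] wf x0 xy; have y0 := lt_le_trans x0 xy.
apply: has_integral_le (wf y y0) (wf x x0) _ => // z /=.
rewrite in_itv /= andbT => z0.
rewrite ler_wpM2l ?w0// lef_pV2 ?posrE ?addr_gt0//; lra.
Qed.

Lemma CB_cauchy_transform f : CB f -> exists2 w, density w & cauchy_transform w (fun x => f x / x).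
Proof.
move=> [w dw wf]; exists w => // x x0.
have := has_integralZ _ _ (measurable_itv _) x^-1 _ _ (wf x x0).
rewrite mulrC (_ : (fun z => _) = fun z => w z / (z + x)) //.
by apply/funext => z; rewrite mulrA mulrA mulVf ?mul1r 1?mulrC// gt_eqF.
Qed.

Lemma CB_ndecr f x y : CB f -> 0 < x -> x <= y -> f x <= f y.
Proof.
move=> [w [mw w0] wf] x0 xy; have y0 := lt_le_trans x0 xy.
apply: (has_integral_le lebesgue_measure `]0, +oo[ (measurable_itv _) _ _ _ _ (wf x x0) (wf y y0)).
move=> z /=; rewrite in_itv /= andbT => z0; rewrite ler_wpM2r ?w0//.
rewrite ler_pdivrMr ?addr_gt0// mulrAC ler_pdivlMr ?addr_gt0//; nra.
Qed.

Definition laplace_transform (mu : {measure set (measurableTypeR R) -> \bar R}) (f : R -> R) :=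
  forall x, 0 < x -> has_integral mu `[0, +oo[ (fun z => expR (- z * x)) (f x).

Lemma laplace_transform_ge0 mu f x : laplace_transform mu f -> 0 < x -> 0 <= f x.
Proof.
move=> muf x0; rewrite -lee_fin (muf x x0).2; apply: integral_ge0 => z _.
by rewrite lee_fin expR_ge0.
Qed.

Lemma laplace_transform_nincr mu f x y : laplace_transform mu f -> 0 < x -> x <= y -> f y <= f x.
Proof.
move=> muf x0 xy; have y0 := lt_le_trans x0 xy.
apply: has_integral_le (muf y y0) (muf x x0) _ => // z /=.
rewrite in_itv /= andbT => z0; rewrite ler_expR; nra.
Qed.

(** Monotone convergence along [x = 1 / (n + 1)]: the kernels increase to 1, and their integrals
    [f x] stay below the limit of [f], which may be infinite. *)
Lemma laplace_transform_mass mu f : laplace_transform mu f ->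
  (mu `[0%R, +oo[%classic <= lim ((f x)%:E @[x --> 0^'+]))%E.
Proof.
move=> muf.
have ni : {in Interval (BRight 0) +oo%O &,
    {homo (fun x => (f x)%:E) : n m / n <= m >-> (m <= n)%E}}.
  move=> x y; rewrite !in_itv /= !andbT => x0 y0 xy; rewrite lee_fin.
  exact: laplace_transform_nincr muf x0 xy.
(* As [f] is nonincreasing, its limit at 0+ is its supremum over the positive reals. *)
have C := nonincreasing_at_right_cvge +oo%O (isT : (BRight 0 < +oo)%O) ni.
rewrite (cvg_lim _ C)//.
have mg n : measurable_fun (`[0, +oo[ : set (measurableTypeR R))
    (fun z => (expR (- z * harmonic n))%:E).
  by have [I _] := muf _ (harmonic_gt0 n); exact: measurable_int I.
have g0 n (z : R) : `[0, +oo[%classic z -> (0 <= (expR (- z * harmonic n))%:E)%E.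
  by rewrite lee_fin expR_ge0.
have gm (z : R) : `[0, +oo[%classic z ->
    {homo (fun n => (expR (- z * harmonic n))%:E) : n m / (n <= m)%N >-> (n <= m)%E}.
  rewrite /= in_itv /= andbT => z0 n m nm.
  by rewrite lee_fin ler_expR !mulNr lerN2 ler_wpM2l// lef_pV2 ?posrE ?ltr0n// ler_nat ltnS.
have MC := @cvg_monotone_convergence _ _ _ mu _ (measurable_itv _) _ mg g0 gm.
have lim1 (z : R) : limn (fun n => (expR (- z * harmonic n))%:E) = 1%E :> \bar R.
  apply/cvg_lim => //; apply: cvg_EFin; first exact: nearW.
  have -> : 1 = expR (- z * 0) :> R by rewrite mulr0 expR0.
  apply: (cvg_comp (fun n => - z * harmonic n) expR); last exact: continuous_expR.
  by apply: cvgM; [exact: cvg_cst | exact: cvg_harmonic].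
have -> : mu `[0%R, +oo[%classic =
    (\int[mu]_(z in `[0%R, +oo[) limn (fun n => (expR (- z * harmonic n))%:E))%E.
  by under eq_integral do rewrite lim1; rewrite integral_cst// mul1e.
rewrite -(cvg_lim _ MC)//; apply: lime_le; first exact: (cvgP _ MC).
apply: nearW => n; have [_ <-] := muf _ (harmonic_gt0 n).
by apply: ereal_sup_ubound; exists (harmonic n) => //=; rewrite in_itv /= harmonic_gt0.
Qed.

Lemma laplace_transform_scaled_error mu f s lmin lmax x : laplace_transform mu f ->
    (0 < size s)%N -> uniq s -> 0 < lmin -> {in s, forall a, lmin <= a <= lmax} ->
    lmin <= x <= lmax -> x \notin s ->
  (`|scaled_error s f x|%:E <=
     (4 * gamma lmin lmax (size s))%:E * lim ((f x)%:E @[x --> 0^'+]))%E.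
Proof.
move=> muf s0 us l0 sl lx xs.
have x0 : 0 < x by case/andP: lx => h _; exact: lt_le_trans h.
have sp : {in s, forall a, 0 < a} by move=> a /sl /andP[h _]; exact: lt_le_trans h.
have H := has_integral_scaled_error _ _ (measurable_itv _) s _ f x muf sp x0.
have G z : 0 <= z -> `|scaled_error s (fun x => expR (- z * x)) x| <= 4 * gamma lmin lmax (size s).
  move=> z0; have := exp_error_gamma s lmin lmax x z s0 us l0 sl lx xs z0.
  congr (`|scaled_error _ _ _| <= _); apply/funext => y; by rewrite mulNr mulrC mulNr.
apply: (@le_trans _ _ ((4 * gamma lmin lmax (size s))%:E * mu `[0%R, +oo[%classic)%E).
  rewrite -integral_cst//; apply: has_integral_norm_le H _ _ => //.
  by move=> z /=; rewrite in_itv /= andbT lee_fin => /G.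
rewrite lee_wpmul2l ?lee_fin ?laplace_transform_mass//.
exact: le_trans (normr_ge0 _) (G 0 _).
Qed.

End Stieltjes.

(** * Norms, adjoints and the spectral theorem for complex matrices *)

Section ComplexMatrices.
Context {R : realType}.
Local Notation C := R[i].

Definition nsq {n} (x : 'cV[C]_n) : R := \sum_i (complex.Re (x i 0) ^+ 2 + complex.Im (x i 0) ^+ 2).

Lemma normc_sq (z : C) : `|z| ^+ 2 = (complex.Re z ^+ 2 + complex.Im z ^+ 2)%:C.
Proof.
case: z => a b; rewrite normc_def /= -rmorphXn /= sqr_sqrtr //.
by rewrite addr_ge0 ?sqr_ge0.
Qed.

Lemma conjc_norm (z : C) : conjc z * z = (complex.Re z ^+ 2 + complex.Im z ^+ 2)%:C.
Proof. by case: z => a b; apply/eqP; rewrite eq_complex /=; apply/andP; split; apply/eqP; ring. Qed.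

Lemma adjmxM m n p (A : 'M[C]_(m, n)) (B : 'M[C]_(n, p)) : adjmx (A *m B) = adjmx B *m adjmx A.
Proof. by rewrite /adjmx trmx_mul map_mxM. Qed.

Lemma adjmxK m n (A : 'M[C]_(m, n)) : adjmx (adjmx A) = A.
Proof. by apply/matrixP => i j; rewrite !mxE conjcK. Qed.

Lemma adjmxB m n (A B : 'M[C]_(m, n)) : adjmx (A - B) = adjmx A - adjmx B.
Proof. by apply/matrixP => i j; rewrite !mxE rmorphB. Qed.

Lemma nsqE n (x : 'cV[C]_n) : (adjmx x *m x) 0 0 = (nsq x)%:C.
Proof.
by rewrite mxE /nsq rmorph_sum; apply: eq_bigr => i _; rewrite !mxE conjc_norm.
Qed.

Lemma nsq_ge0 n (x : 'cV[C]_n) : 0 <= nsq x.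
Proof. by apply: sumr_ge0 => i _; rewrite addr_ge0 ?sqr_ge0. Qed.

Lemma nsq_eq0 n (x : 'cV[C]_n) : nsq x = 0 -> x = 0.
Proof.
move=> /eqP; rewrite psumr_eq0; last by move=> i _; rewrite addr_ge0 ?sqr_ge0.
move=> /allP h; apply/matrixP => i j; rewrite ord1 mxE.
have := h i (mem_index_enum _); rewrite paddr_eq0 ?sqr_ge0// !sqrf_eq0.
by case: (x i 0) => a b /= /andP[/eqP-> /eqP->].
Qed.

(** By the parallelogram law the gap is [nsq (x + y)]. *)
Lemma nsqB_le n (x y : 'cV[C]_n) : nsq (x - y) <= 2 * nsq x + 2 * nsq y.
Proof.
rewrite /nsq !mulr_sumr -big_split; apply: ler_sum => i _; rewrite !mxE.
case: (x i 0) (y i 0) => [a b] [c d] /=.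
rewrite -subr_ge0 (_ : _ - _ = (a + c) ^+ 2 + (b + d) ^+ 2); last by ring.
by rewrite addr_ge0 ?sqr_ge0.
Qed.

Lemma norm2E n (x : 'cV[C]_n) : norm2 x = Num.sqrt (nsq x).
Proof. by []. Qed.

Lemma nsq_isometry n (U : 'M[C]_n) x : adjmx U *m U = 1%:M -> nsq (U *m x) = nsq x.
Proof.
move=> UU; suff: (nsq (U *m x))%:C = (nsq x)%:C by case.
by rewrite -!nsqE adjmxM -mulmxA (mulmxA (adjmx U)) UU mul1mx.
Qed.

(** Pythagoras, with orthogonal parts [P *m x] and [x - P *m x]. *)
Lemma nsq_proj_le n (P : 'M[C]_n) x : adjmx P = P -> P *m P = P -> nsq (P *m x) <= nsq x.
Proof.
move=> hP PP; have h : (nsq (P *m x))%:C = (nsq x)%:C - (nsq (x - P *m x))%:C.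
  have e : adjmx x *m P *m (P *m x) = adjmx x *m (P *m x).
    by rewrite -[LHS]mulmxA (mulmxA P P) PP.
  rewrite -!nsqE !(adjmxB, adjmxM) hP mulmxBl !mulmxBr e -(mulmxA (adjmx x) P x) subrr subr0.
  by rewrite !mxE opprB addrC subrK.
have : nsq (P *m x) = nsq x - nsq (x - P *m x) by move: h => -[].
by move=> ->; rewrite gerBl nsq_ge0.
Qed.

Lemma adjmxE m n (A : 'M[C]_(m, n)) : adjmx A = map_mx (@Num.conj C) A^T.
Proof. by []. Qed.

Lemma hermitian_spectral n (A : 'M[C]_n) : adjmx A = A -> exists U : 'M[C]_n, exists d : 'rV[C]_n,
  [/\ U *m adjmx U = 1%:M, adjmx U *m U = 1%:M & A = adjmx U *m diag_mx d *m U].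
Proof.
move=> hA; have nA : A \is normalmx.
  by apply/normalmxP; rewrite -adjmxE hA.
have Uu := spectral_unitarymx A.
exists (spectralmx A), (spectral_diag A); split.
- by have /unitarymxP := Uu; rewrite -adjmxE.
- by have := Uu; rewrite -trmxC_unitary => /unitarymxP; rewrite -!adjmxE adjmxK.
- by have /orthomx_spectralP := nA; rewrite invmx_unitary // -adjmxE.
Qed.

End ComplexMatrices.

(** * Polynomial interpolation and functions of compressed Hermitian matrices *)

Lemma poly_interpolation (K : fieldType) (s : seq K) (v : K -> K) : uniq s ->
  exists p : {poly K}, {in s, forall a, p.[a] = v a}.
Proof.
elim: s => [|m s IH] /=; first by exists 0.
move=> /andP[ms /IH [p hp]].
pose w := \prod_(a <- s) ('X - a%:P).
have wm : w.[m] != 0.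
  by apply: contraNneq ms => /eqP; rewrite -[_ == 0]/(root w m) root_prod_XsubC.
exists (p + ((v m - p.[m]) / w.[m]) *: w) => a; rewrite inE hornerD hornerZ.
case/predU1P => [->|as_]; first by rewrite divfK// addrC subrK.
have /eqP -> : root w a by rewrite root_prod_XsubC.
by rewrite mulr0 addr0 hp.
Qed.

Section Compression.
Context {R : realType}.
Local Notation C := R[i].
Variables (n m : nat) (A : 'M[C]_n.+1) (V : 'M[C]_(n.+1, m.+1)) (X : 'M[C]_(m.+1, n.+1)).
Variables (a b : R).
(** The hypotheses on [X] make [V *m X] the orthogonal projection onto the column space of [V].
    Spectral bounds on [A] are stated through Rayleigh quotients because these pass to
    compressions. *)
Hypothesis hA : adjmx A = A.
Hypothesis rayleigh : forall v : 'cV[C]_n.+1,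
  a * nsq v <= complex.Re ((adjmx v *m A *m v) 0 0) <= b * nsq v.
Hypothesis XV : X *m V = 1%:M.
Hypothesis hP : adjmx (V *m X) = V *m X.

Local Notation P := (V *m X).
Local Notation H := (X *m A *m V).

Lemma proj_idem : P *m P = P.
Proof. by rewrite -mulmxA (mulmxA X) XV mul1mx. Qed.

(** As the columns of [V] may fail to be orthonormal, [H] may fail to be Hermitian; this identity
    moves its polynomials over to [P *m A *m P], which is Hermitian. *)
Lemma horner_mx_compression p : V *m horner_mx H p *m X = horner_mx (P *m A *m P) p *m P.
Proof.
elim/poly_ind: p => [|p c IH]; first by rewrite !rmorph0 mulmx0 !mul0mx.
rewrite !rmorphD !rmorphM /= !horner_mx_X !horner_mx_C -!mulmxE mulmxDr !mulmxDl.
congr (_ + _); last by rewrite mul_mx_scalar -scalemxAl mul_scalar_mx.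
by rewrite !mulmxA IH -!mulmxA (mulmxA X V) XV mul1mx.
Qed.

(** For a left eigenvector [y] of [H], the vector [v = adjmx (y *m X)] is fixed by [P], and [t] is
    its Rayleigh quotient for [A], real since [A] is Hermitian. *)
Lemma compression_eigenvalue t : eigenvalue H t -> exists2 r : R, t = r%:C & a <= r <= b.
Proof.
move=> /eigenvalueP[y yH y0].
pose v := adjmx (y *m X).
have e : adjmx v *m A *m v = t *: (adjmx v *m v).
  have vP : P *m v = v by rewrite /v -{1}hP -adjmxM -mulmxA (mulmxA X) XV mul1mx.
  have av : adjmx v = y *m X by rewrite adjmxK.
  clearbody v; rewrite av -[in LHS]vP.
  transitivity (y *m H *m (X *m v)); first by rewrite !mulmxA.
  by rewrite yH -scalemxAl mulmxA.
have v0 : 0 < nsq v.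
  rewrite lt_neqAle nsq_ge0 andbT eq_sym; apply: contra_neq y0 => /nsq_eq0 v0.
  have : y *m X = 0 by rewrite -[y *m X]adjmxK -/v v0; apply/matrixP => i j; rewrite !mxE conjc0.
  by move=> /(congr1 (mulmx^~ V)); rewrite -mulmxA XV mulmx1 mul0mx.
have e1 : (adjmx v *m A *m v) 0 0 = t * (nsq v)%:C by rewrite e mxE nsqE.
have hr : conjc ((adjmx v *m A *m v) 0 0) = (adjmx v *m A *m v) 0 0.
  have -> : conjc ((adjmx v *m A *m v) 0 0) = adjmx (adjmx v *m A *m v) 0 0 by rewrite !mxE.
  by rewrite !adjmxM adjmxK hA mulmxA.
have zr : (adjmx v *m A *m v) 0 0 = (complex.Re ((adjmx v *m A *m v) 0 0))%:C.
  move: hr; case: ((adjmx v *m A *m v) 0 0) => r1 r2 /= [h].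
  by congr (_ +i* _); move: h; lra.
have nv0 : (nsq v)%:C != 0 by rewrite eq_complex /= eqxx andbT gt_eqF.
exists (complex.Re ((adjmx v *m A *m v) 0 0) / nsq v).
  by rewrite rmorphM fmorphV /= -zr e1 mulfK.
by rewrite ler_pdivlMr// ler_pdivrMr.
Qed.

Lemma horner_mx_compression_bound (p : {poly C}) (M : R) v : 0 <= M ->
    (forall t, eigenvalue H t -> `|p.[t]| <= M%:C) ->
  nsq (V *m horner_mx H p *m X *m v) <= M ^+ 2 * nsq v.
Proof.
move=> M0 pM; rewrite horner_mx_compression.
have hG : adjmx (P *m A *m P) = P *m A *m P by rewrite adjmxM hP adjmxM hP hA mulmxA.
have [U [d [UU' U'U GE]]] := hermitian_spectral _ _ hG.
have Uu : U \is a GRing.unit by case/mulmx1_unit: UU'.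
have Ui : invmx U = adjmx U by rewrite -[RHS]mul1mx -(mulVmx Uu) -mulmxA UU' mulmx1.
(* On the complement of the column space of [V], [P *m A *m P] has the eigenvalue 0, where [p] is
   not controlled. A nonzero coordinate of [P *m v] rules this case out: then [row i U *m V] is
   nonzero and is a left eigenvector of [H]. *)
have eig i j : (U *m (P *m v)) i j != 0 -> eigenvalue H (d 0 i).
  move=> ne0; apply/eigenvalueP; exists (row i U *m V); last first.
    apply: contraNneq ne0 => z.
    have : row i (U *m (P *m v)) = 0 by rewrite row_mul -mulmxA mulmxA z mul0mx.
    by move=> /matrixP /(_ 0 j); rewrite [in LHS]mxE => ->; rewrite mxE.
  have uG : row i U *m (P *m A *m P) = d 0 i *: row i U.
    rewrite GE -row_mul !mulmxA UU' mul1mx.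
    by apply/rowP => l; rewrite [LHS]mxE mul_diag_mx !mxE.
  have := congr1 (mulmx^~ V) uG; rewrite -scalemxAl => <-.
  rewrite !mulmxA -!mulmxA; congr (_ *m (_ *m (_ *m _))).
  by rewrite XV mulmx1.
rewrite {1}GE -Ui horner_mx_uconjC // horner_mx_diag Ui -!mulmxA.
rewrite nsq_isometry ?adjmxK//.
apply: le_trans (_ : M ^+ 2 * nsq (U *m (P *m v)) <= _); last first.
  by rewrite ler_wpM2l ?sqr_ge0// nsq_isometry // nsq_proj_le // proj_idem.
rewrite (mulmxA V X v); move: (U *m (P *m v)) eig => w eig.
rewrite /nsq mulr_sumr mul_diag_mx; apply: ler_sum => i _; rewrite !mxE.
have [->|/eig /pM le] := eqVneq (w i 0) 0; first by rewrite mulr0 /= expr0n addr0 mulr0.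
rewrite -lecR [leRHS]rmorphM /= -!normc_sq normrM exprMn. rewrite ler_wpM2r ?exprn_ge0//.
by rewrite rmorphXn lerXn2r // nnegrE ?(le_trans _ le)//.
Qed.

(** The preceding bound with [M = 0]; in effect, [H] is diagonalizable. *)
Lemma horner_mx_compression_eq0 p : (forall t, eigenvalue H t -> p.[t] = 0) -> horner_mx H p = 0.
Proof.
move=> p0; have z : V *m horner_mx H p *m X = 0.
  apply/matrixP => i j; have := horner_mx_compression_bound p 0 (delta_mx j 0) (lexx 0).
  rewrite expr0n mul0r => h.
  have /nsq_eq0 : nsq (V *m horner_mx H p *m X *m delta_mx j 0) = 0.
    by apply: le_anti; rewrite nsq_ge0 h // => t /p0 ->; rewrite normr0 lecR.
  by rewrite -colE => /matrixP /(_ i 0); rewrite !mxE.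
have : X *m (V *m horner_mx H p *m X) *m V = 0 by rewrite z mulmx0 mul0mx.
by rewrite !mulmxA XV mul1mx -mulmxA XV mulmx1.
Qed.

Lemma eigenvalue_seq : exists2 rs : seq C, uniq rs & forall t, eigenvalue H t = (t \in rs).
Proof.
have [r hr] := closed_field_poly_normal (mxminpoly H).
exists (undup r); first exact: undup_uniq.
move=> t; rewrite mem_undup eigenvalue_root_min hr (monicP (mxminpoly_monic _)) scale1r.
by rewrite root_prod_XsubC.
Qed.

(** The minimal polynomial of [H] has simple roots, so the interpolation conditions in [matfun]
    involve no derivatives. They can be met, hence [xget] does not return its default. *)
Lemma matfun_compression (F : C -> C) : exists2 p : {poly C}, matfun F H = horner_mx H p &
  forall t, eigenvalue H t -> p.[t] = F t.
Proof.
have [rs urs eig] := eigenvalue_seq.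
have [q hq] := poly_interpolation _ rs F urs.
have mup1 t : (mup t (mxminpoly H) <= 1)%N.
  have d : mxminpoly H %| \prod_(r <- rs) ('X - r%:P).
    apply: mxminpoly_min; apply: horner_mx_compression_eq0 => r.
    by rewrite eig -root_prod_XsubC => /eqP.
  have m0 : mxminpoly H != 0 by rewrite monic_neq0// mxminpoly_monic.
  have w0 : \prod_(r <- rs) ('X - r%:P) != 0 by rewrite monic_neq0// monic_prod_XsubC.
  have le : (mup t (mxminpoly H) <= mup t (\prod_(r <- rs) ('X - r%:P)))%N.
    by rewrite mup_geq//; apply: dvdp_trans d; rewrite -mup_geq.
  by apply: leq_trans le _; rewrite mu_prod_XsubC count_uniq_mem// leq_b1.
have mup0 t : (0 < mup t (mxminpoly H))%N = eigenvalue H t.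
  by rewrite eigenvalue_root_min -XsubC_dvd ?dvdp_XsubCl// monic_neq0// mxminpoly_monic.
pose S := [set B | exists p : {poly C}, B = horner_mx H p /\
    forall (z : C) (j : nat), (j < mup z (mxminpoly H))%N ->
      (derivn j p).[z] = derive1n j (cfun_regular F) z].
have : S (matfun F H).
  apply: (xgetPex 0); exists (horner_mx H q); exists q; split => // z [|j].
    by rewrite mup0 eig => /hq.
  by rewrite ltnNge (leq_trans (mup1 z)).
move=> [p [-> hp]]; exists p => // t te; have := hp t 0%N; rewrite mup0 => /(_ te) //.
Qed.

(** Exactness on the Krylov space: since [P] fixes [A ^+ j *m c] for [j <= k], it can be inserted
    after each factor [A], turning powers of [A] into powers of [H]. *)
Lemma horner_mx_krylov (c : 'cV[C]_n.+1) k (p : {poly C}) :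
    (forall j, (j <= k)%N -> P *m (A ^+ j *m c) = A ^+ j *m c) -> (size p <= k.+1)%N ->
  X *m (horner_mx A p *m c) = horner_mx H p *m (X *m c) /\
  P *m (horner_mx A p *m c) = horner_mx A p *m c.
Proof.
move=> Pc sp.
have pow j : (j <= k)%N -> X *m (A ^+ j *m c) = H ^+ j *m (X *m c).
  elim: j => [|j IH] jk; first by rewrite !expr0 !mul1mx.
  rewrite [H ^+ _]exprS -mulmxE -(mulmxA H) -IH ?(ltnW jk)// exprS -mulmxE.
  by rewrite -!mulmxA (mulmxA V X) Pc ?(ltnW jk).
have hp l (B : 'M[C]_l.+1) : horner_mx B p = \sum_(i < size p) p`_i *: B ^+ i.
  rewrite -[p in LHS]coefK poly_def rmorph_sum; apply: eq_bigr => i _.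
  by rewrite /= horner_mxZ rmorphXn /= horner_mx_X.
rewrite !hp !mulmx_suml !mulmx_sumr; split; apply: eq_bigr => i _;
  have ik : (i <= k)%N by rewrite -ltnS (leq_trans _ sp).
- by rewrite -scalemxAl -scalemxAr pow// scalemxAl.
- by rewrite -scalemxAl -scalemxAr Pc.
Qed.

(** Let [chi] interpolate [F - p / q] on the spectrum of [H]. By exactness for [p] and [q] the
    difference equals [V *m horner_mx H chi *m X *m v], and [chi] is bounded by [M] on that
    spectrum. *)
Lemma compression_error (F : C -> C) (f : R -> R) (c : 'cV[C]_n.+1) k (p q : {poly R}) (M : R) :
    0 <= M -> a <= b -> (forall x, a <= x <= b -> F x%:C = (f x)%:C) ->
    (forall j, (j <= k)%N -> P *m (A ^+ j *m c) = A ^+ j *m c) ->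
    (size p <= k.+1)%N -> (size q <= k.+1)%N ->
    (forall x, a <= x <= b -> q.[x] != 0 /\ `|f x - p.[x] / q.[x]| <= M) ->
  let pC := map_poly (real_complex R) p in let qC := map_poly (real_complex R) q in
  let v := horner_mx A qC *m c in
  nsq (V *m matfun F H *m X *m v - horner_mx A pC *m c) <= M ^+ 2 * nsq v.
Proof.
move=> M0 ab Ff Pc sp sq pq /=.
set pC := map_poly _ p; set qC := map_poly _ q; set v := horner_mx A qC *m c.
have spC : (size pC <= k.+1)%N by rewrite size_map_poly.
have sqC : (size qC <= k.+1)%N by rewrite size_map_poly.
have [phi -> hphi] := matfun_compression F.
have [rs urs eig] := eigenvalue_seq.
have [chi hchi] := poly_interpolation _ rs (fun t => F t - pC.[t] / qC.[t]) urs.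
have [Xq _] := horner_mx_krylov _ _ _ Pc sqC.
have [Xp Pp] := horner_mx_krylov _ _ _ Pc spC.
have -> : V *m horner_mx H phi *m X *m v - horner_mx A pC *m c = V *m horner_mx H chi *m X *m v.
  have eV r : V *m horner_mx H r *m X *m v = V *m (horner_mx H (r * qC) *m (X *m c)).
    by rewrite rmorphM /= -mulmxE /v -!mulmxA Xq !mulmxA.
  have ep : horner_mx A pC *m c = V *m (horner_mx H pC *m (X *m c)) by rewrite -Pp -mulmxA Xp.
  rewrite !eV ep -mulmxBr -mulmxBl -rmorphB; congr (_ *m (_ *m _)).
  (* It suffices that [phi * qC - pC] and [chi * qC] agree on the spectrum of [H]; no inverse of
     [q(H)] is formed. *)
  apply/eqP; rewrite -subr_eq0 -rmorphB; apply/eqP/horner_mx_compression_eq0 => t te.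
  have [r tr rab] := compression_eigenvalue _ te; have [q0 _] := pq r rab.
  have := te; rewrite eig => /hchi; rewrite !hornerE hphi// => ->.
  rewrite mulrBl divfK ?subrr// tr horner_map fmorph_eq0 //.
apply: horner_mx_compression_bound => // t te.
have [r tr rab] := compression_eigenvalue _ te; have [q0 le] := pq r rab.
have := te; rewrite eig => /hchi ->; rewrite tr !horner_map Ff//.
rewrite -fmorph_div -rmorphB /= normc_def /= expr0n addr0 sqrtr_sqr lecR //.
Qed.

End Compression.

(** * The spectrum of [L] and its Rayleigh quotients *)

Section Spectrum.
Context {R : realType}.
Local Notation C := R[i].
Variables (n : nat) (L : 'M[R]_n.+1).
Hypothesis Ldiag : diagonalizable L.

Lemma diagonalizable_spectrum : exists rs : seq R, [/\ rs != [::],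
  mxminpoly L = \prod_(r <- rs) ('X - r%:P) & forall a, eigenvalue L a = (a \in rs)].
Proof.
have [Q Qu /diagonalizable_forPex[d LD]] := Ldiag.
have mp := simmx_minpoly Qu LD; rewrite mxminpoly_diag in mp.
exists (undup [seq d 0 i | i <- enum 'I_n.+1]); split => //.
  rewrite -size_eq0 -eqSS -(size_prod_XsubC _ id) -mp size_mxminpoly eqSS.
  by rewrite -lt0n mxminpoly_nonconstant.
by move=> a; rewrite eigenvalue_root_min mp root_prod_XsubC.
Qed.

Lemma seq_min (s : seq R) : s != [::] -> exists2 m, m \in s & {in s, forall a, m <= a}.
Proof.
elim: s => // x s IH _; have [->|/IH [m ms mle]] := eqVneq s [::].
  by exists x; rewrite ?mem_head// => a; rewrite inE => /eqP ->.
have [xm|mx] := leP x m.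
  exists x; rewrite ?mem_head// => a; rewrite inE => /predU1P[->//|/mle]; exact: le_trans.
exists m; rewrite ?inE ?ms ?orbT// => a; rewrite inE => /predU1P[->|/mle //]; exact: ltW.
Qed.

Lemma lambda_min_eigenvalue : eigenvalue L (lambda_min L).
Proof.
have [rs [rs0 _ eig]] := diagonalizable_spectrum.
have [m ms mle] := seq_min _ rs0.
suff -> : lambda_min L = m by rewrite eig.
have lb : lbound [set a | eigenvalue L a] m by move=> a /=; rewrite eig => /mle.
apply/le_anti/andP; split.
  by apply: ge_inf => /=; [exists m | rewrite eig].
by apply: lb_le_inf => //; exists m => /=; rewrite eig.
Qed.

Lemma eigenvalue_bounds a : eigenvalue L a -> lambda_min L <= a <= lambda_max L.
Proof.
have [rs [rs0 _ eig]] := diagonalizable_spectrum.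
have [m ms mle] := seq_min _ rs0.
have [m' _ mle'] : exists2 m', m' \in map -%R rs & {in map -%R rs, forall a, m' <= a}.
  by apply: seq_min; rewrite -size_eq0 size_map size_eq0.
move=> ea; apply/andP; split.
  by apply: ge_inf => //; exists m => c /=; rewrite eig => /mle.
apply: ub_le_sup => //; exists (- m') => c /=; rewrite eig => cs.
by rewrite lerNr; apply: mle'; exact: map_f.
Qed.

Lemma lambda_min_le_max : lambda_min L <= lambda_max L.
Proof. by have /andP[] := eigenvalue_bounds _ lambda_min_eigenvalue. Qed.

Hypothesis Lpos : posdefmx L.

Lemma eigenvalue_gt0 a : eigenvalue L a -> 0 < a.
Proof.
move=> /eigenvalueP[v vL v0].
have := Lpos v^T; rewrite trmx_eq0 trmxK vL -scalemxAl mxE => /(_ v0) h.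
have s0 : 0 <= (v *m v^T) 0 0.
  by rewrite mxE; apply: sumr_ge0 => i _; rewrite mxE -expr2 sqr_ge0.
by rewrite ltNge; apply/negP => a0; move: h; rewrite ltNge mulr_le0_ge0.
Qed.

Lemma lambda_min_gt0 : 0 < lambda_min L.
Proof. exact: eigenvalue_gt0 lambda_min_eigenvalue. Qed.

Hypothesis Lsym : L^T = L.

Lemma mxC_hermitian : adjmx (mxC L) = mxC L.
Proof.
by apply/matrixP => i j; rewrite !mxE -[in RHS]Lsym mxE /= oppr0.
Qed.

Lemma mxC_rayleigh (v : 'cV[C]_n.+1) :
  lambda_min L * nsq v <= complex.Re ((adjmx v *m mxC L *m v) 0 0) <= lambda_max L * nsq v.
Proof.
have [U [d [UU' U'U LE]]] := hermitian_spectral _ _ mxC_hermitian.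
have [rs [_ mp eig]] := diagonalizable_spectrum.
(* The entries of [d] are roots of the minimal polynomial of [L], which splits over the reals
   because [L] is diagonalizable; so they are real eigenvalues of [L]. *)
have dr i : exists2 r : R, d 0 i = r%:C & lambda_min L <= r <= lambda_max L.
  have : eigenvalue (mxC L) (d 0 i).
    apply/eigenvalueP; exists (row i U).
      rewrite LE -row_mul !mulmxA UU' mul1mx.
      by apply/rowP => l; rewrite [LHS]mxE mul_diag_mx !mxE.
    apply: contraTneq (oner_neq0 C) => z; rewrite negbK.
    have := congr1 (fun B : 'M[C]_n.+1 => B i i) UU'; rewrite [in RHS]mxE eqxx mulr1n => <-.
    have : row i (U *m adjmx U) = 0 by rewrite row_mul z mul0mx.
    by move=> /matrixP /(_ 0 i); rewrite [in LHS]mxE => ->; rewrite mxE.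
  rewrite eigenvalue_root_min mxminpoly_map mp.
  rewrite rmorph_prod /= (eq_bigr (fun r => 'X - (r%:C)%:P)); last first.
    by move=> r _; rewrite rmorphB /= map_polyX map_polyC.
  rewrite -(big_map (real_complex R) xpredT (fun z => 'X - z%:P)) root_prod_XsubC.
  by move=> /mapP[r rrs ->]; exists r => //; apply: eigenvalue_bounds; rewrite eig.
have -> : adjmx v *m mxC L *m v = adjmx (U *m v) *m (diag_mx d *m (U *m v)).
  by rewrite LE adjmxM !mulmxA.
rewrite -(nsq_isometry _ U v U'U).
move: (U *m v) => w; rewrite mul_diag_mx mxE raddf_sum /nsq !mulr_sumr.
have E i : complex.Re (adjmx w 0 i * (\matrix_(i, j) (d 0 i * w i j)) i 0) =
   complex.Re (d 0 i) * (complex.Re (w i 0) ^+ 2 + complex.Im (w i 0) ^+ 2).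
  have [r dE _] := dr i.
  by rewrite !mxE dE; case: (w i 0) => x y /=; ring.
apply/andP; split; apply: ler_sum => i _; rewrite /= E; have [r -> /andP[r1 r2]] := dr i;
  by rewrite ler_wpM2r// addr_ge0 ?sqr_ge0.
Qed.

End Spectrum.

(** * The Moore-Penrose inverse for full column rank *)

Section PseudoInverse.
Context {R : realType}.
Local Notation C := R[i].

Lemma adjmx1 n : adjmx (1%:M : 'M[C]_n) = 1%:M.
Proof.
by apply/matrixP => i j; rewrite !mxE eq_sym; case: eqP => _; rewrite ?conjc0 ?conjc1.
Qed.

(** The Gram matrix [G] is invertible and [invmx G *m adjmx V] satisfies the four equations, so
    [xget] does not return its default. *)
Lemma mpinv_penrose n k (V : 'M[C]_(n, k)) : row_free V^T -> penrose V (mpinv V).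
Proof.
move=> fV; pose G := adjmx V *m V.
have hG : adjmx G = G by rewrite /G adjmxM adjmxK.
have Gu : G \in unitmx.
  rewrite -row_free_unit; apply/inj_row_free => y yG.
  pose z := adjmx y.
  have Gz : G *m z = 0 by rewrite /z -hG -adjmxM yG; apply/matrixP => i j; rewrite !mxE conjc0.
  have Vz : V *m z = 0.
    apply: nsq_eq0; suff : (nsq (V *m z))%:C = 0 by case.
    by rewrite -nsqE adjmxM -mulmxA (mulmxA _ V) -/G Gz mulmx0 mxE.
  have : z^T *m V^T = 0 by rewrite -trmx_mul Vz trmx0.
  move/eqP; rewrite mulmx_free_eq0// trmx_eq0 => /eqP z0.
  by rewrite -[y]adjmxK -/z z0; apply/matrixP => i j; rewrite !mxE conjc0.
have hGi : adjmx (invmx G) = invmx G.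
  rewrite -[LHS]mulmx1 -(mulmxV Gu) mulmxA -[X in _ *m X *m _]hG -adjmxM.
  by rewrite mulmxV// adjmx1 mul1mx.
apply: (xgetPex 0); exists (invmx G *m adjmx V).
have e1 : invmx G *m adjmx V *m V = 1%:M by rewrite -mulmxA mulVmx.
split.
- by rewrite -mulmxA e1 mulmx1.
- by rewrite e1 mul1mx.
- by rewrite !adjmxM adjmxK hGi mulmxA.
- by rewrite e1 adjmx1.
Qed.

Lemma mpinv_left n k (V : 'M[C]_(n, k)) : row_free V^T -> mpinv V *m V = 1%:M.
Proof.
move=> fV; have [e _ _ _] := mpinv_penrose _ _ _ fV.
apply: trmx_inj; apply: (row_free_inj fV).
by rewrite trmx1 mul1mx -!trmx_mul mulmxA e.
Qed.

End PseudoInverse.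

(** * From rational approximation on the spectral interval to the Krylov error *)

Section ErrorBound.
Context {R : realType}.
Local Notation C := R[i].

(** Empty and unbounded sets are covered too: there [sup] is 0 by default. *)
Lemma sup_nonneg (S : set R) : (forall x, S x -> 0 <= x) -> 0 <= sup S.
Proof.
move=> S0; have [hs|/sup_out -> //] := pselect (has_sup S).
by have [x Sx] := hs.1; apply: le_trans (S0 x Sx) _; apply: ub_le_sup => //; exact: hs.2.
Qed.

Variables (n k : nat) (L : 'M[R]_n.+1) (b : 'cV[R]_n.+1) (xi : 'I_k -> R).
Hypotheses (Ldiag : diagonalizable L) (Lpos : posdefmx L).
Hypothesis hxi : forall j, - xi j \in `[lambda_min L, lambda_max L].

Local Notation lmin := (lambda_min L).
Local Notation lmax := (lambda_max L).

Lemma supnorm_ge0 (g : R -> R) : 0 <= sigma_norm L g.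
Proof. by apply: sup_nonneg => _ [x _ <-]. Qed.

Lemma supnorm_le (g : R -> R) M : (forall x, lmin <= x <= lmax -> `|g x| <= M) -> sigma_norm L g <= M.
Proof.
move=> gM; apply: ge_sup.
  by exists `|g lmin|, lmin => //=; rewrite in_itv /= lexx lambda_min_le_max.
by move=> y [x /=]; rewrite in_itv /= => xab <-; exact: gM.
Qed.

Lemma best_approx_le (f : R -> R) (p : {poly R}) M : (size p <= k.+1)%N ->
    (forall x, lmin <= x <= lmax -> `|f x - p.[x] / (Defs.qpoly xi).[x]| <= M) ->
  best_approx L xi f <= M.
Proof.
move=> sp pM; apply: le_trans (supnorm_le _ _ pM).
apply: ge_inf; last by exists p.
by exists 0 => _ [q _ <-]; exact: supnorm_ge0.
Qed.

(** Outside the self-adjoint case, apply the Crouzeix estimate to the constant function 1, whose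
    maximum norm is 1. *)
Lemma crouzeix_constant_ge0 (V : 'M[C]_(n.+1, k.+1)) K : crouzeix_constant L b xi V K -> 0 <= K.
Proof.
move=> [_ sa cr _]; have [/sa ->|/cr cK] := pselect (L^T = L); first exact: ler01.
have h : holo_ext (fun=> 1) (fun=> 1 : C) by split => // z _; exact: derivable_cst.
have := cK _ _ h.
have -> : sigma_norm L (fun=> 1) = 1.
  rewrite /sigma_norm /supnorm (_ : [set _ | _ in _] = [set 1]) ?sup1//.
  apply/seteqP; split => [_ [x _ <-]|_ ->]; first by rewrite normr1.
  by exists lmin; rewrite ?normr1//= in_itv /= lexx lambda_min_le_max.
have : 0 <= opnorm (matfun (fun=> 1 : C) (mxC L)).
  by apply: sup_nonneg => _ [x _ <-]; rewrite sqrtr_ge0.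
lra.
Qed.

Lemma qpolyE x : (Defs.qpoly xi).[x] = \prod_j (x - xi j).
Proof. by rewrite horner_prod; apply: eq_bigr => j _; rewrite hornerXsubC. Qed.

Lemma xi_lt0 j : xi j < 0.
Proof.
have := hxi j; rewrite in_itv /= => /andP[h _].
by rewrite -oppr_gt0 (lt_le_trans (lambda_min_gt0 _ L Ldiag Lpos) h).
Qed.

Lemma qpoly_neq0 x : 0 < x -> (Defs.qpoly xi).[x] != 0.
Proof.
move=> x0; rewrite qpolyE; apply/prodf_neq0 => j _; rewrite gt_eqF// subr_gt0.
exact: lt_trans (xi_lt0 j) x0.
Qed.

Lemma qpoly_unit : horner_mx L (Defs.qpoly xi) \in unitmx.
Proof.
rewrite rmorph_prod /=; apply: (big_ind (fun B => B \in unitmx)) => [||j _].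
- exact: unitmx1.
- by move=> B1 B2 u1 u2; rewrite -mulmxE unitmx_mul u1.
rewrite rmorphB /= horner_mx_X horner_mx_C.
have : ~~ eigenvalue L (xi j).
  by apply/negP => /(eigenvalue_gt0 _ L Lpos); rewrite ltNge (ltW (xi_lt0 j)).
by rewrite /eigenvalue /eigenspace negbK kermx_eq0 row_free_unit.
Qed.

Lemma mxC_horner (p : {poly R}) :
  mxC (horner_mx L p) = horner_mx (mxC L) (map_poly (real_complex R) p).
Proof. by rewrite /mxC map_horner_mx. Qed.

Variables (V : 'M[C]_(n.+1, k.+1)) (F : C -> C) (f : R -> R).
Hypothesis hV : rat_krylov_basis L b xi V.
Hypothesis hF : holo_ext f F.

(** With [c = q(L)^-1 b], both [F(L) b] and its Krylov approximation are compared with [p(L) c], and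
    each is within [M * norm2 (mxC b)] of it. *)
Lemma selfadjoint_error_le (p : {poly R}) M : L^T = L -> (size p <= k.+1)%N -> 0 <= M ->
    (forall x, lmin <= x <= lmax -> `|f x - p.[x] / (Defs.qpoly xi).[x]| <= M) ->
  krylov_error L b V F <= 2 * norm2 (mxC b) * M.
Proof.
move=> Lsym sp M0 pM; have /andP[Vfree /andP[_ VK]] := hV.
have l0 := lambda_min_gt0 _ L Ldiag Lpos.
pose A := mxC L; pose X := mpinv V.
have XV : X *m V = 1%:M := mpinv_left _ _ _ Vfree.
have [_ _ hP _] := mpinv_penrose _ _ _ Vfree.
have hA := mxC_hermitian _ L Lsym.
have ray := mxC_rayleigh _ L Ldiag Lsym.
pose c0 := invmx (horner_mx L (Defs.qpoly xi)) *m b.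
pose c := mxC c0.
have bE : mxC b = horner_mx A (map_poly (real_complex R) (Defs.qpoly xi)) *m c.
  by rewrite -mxC_horner /c /mxC -map_mxM /c0 mulKVmx// qpoly_unit.
have Pc j : (j <= k)%N -> V *m X *m (A ^+ j *m c) = A ^+ j *m c.
  move=> jk; have AE : A ^+ j *m c = mxC (invmx (horner_mx L (Defs.qpoly xi)) *m L ^+ j *m b).
    rewrite /A /c /mxC -rmorphXn -map_mxM /c0; congr map_mx.
    rewrite mulmxA; congr (_ *m _).
    have Lq : L ^+ j *m horner_mx L (Defs.qpoly xi) = horner_mx L (Defs.qpoly xi) *m L ^+ j.
      by rewrite -[L in L ^+ j]horner_mx_X -rmorphXn !mulmxE -!rmorphM mulrC.
    by rewrite -[RHS]mulmx1 -(mulmxV qpoly_unit) mulmxA -(mulmxA (invmx _)) Lq mulKmx ?qpoly_unit.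
  have : ((A ^+ j *m c)^T <= V^T)%MS.
    rewrite AE; apply: submx_trans VK.
    have -> : (mxC (invmx (horner_mx L (Defs.qpoly xi)) *m L ^+ j *m b))^T =
        row (Ordinal (jk : (j < k.+1)%N)) (mxC (rat_krylov L b xi)).
      by apply/rowP => l; rewrite !mxE.
    exact: row_sub.
  move=> /submxP[D /(congr1 trmx)]; rewrite trmxK trmx_mul trmxK => ->.
  by rewrite -mulmxA (mulmxA X) XV mul1mx.
have Ff x : lmin <= x <= lmax -> F x%:C = (f x)%:C.
  by move=> /andP[lx _]; apply: hF.1; exact: lt_le_trans lx.
have sq : (size (Defs.qpoly xi) <= k.+1)%N by rewrite size_prod_XsubC -[index_enum _]enumT size_enum_ord.
have pq x : lmin <= x <= lmax ->
    (Defs.qpoly xi).[x] != 0 /\ `|f x - p.[x] / (Defs.qpoly xi).[x]| <= M.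
  move=> xab; split; last exact: pM.
  by apply: qpoly_neq0; case/andP: xab => lx _; exact: lt_le_trans lx.
have lm := lambda_min_le_max _ L Ldiag.
have e1 := compression_error n k A V X lmin lmax hA ray XV hP F f c k p (Defs.qpoly xi) M
  M0 lm Ff Pc sp sq pq.
(* With both [V] and [X] the identity, the compression is [A] itself, which gives the bound for
   [F(L) b]. *)
have := compression_error n n A 1%:M 1%:M lmin lmax hA ray (mul1mx _) _ F f c k p (Defs.qpoly xi) M
  M0 lm Ff _ sp sq pq.
rewrite !mul1mx !mulmx1 => /(_ (adjmx1 _) (fun j _ => mul1mx _)) e2.
rewrite /= -bE in e1 e2.
rewrite /krylov_error /krylov_approx /compression !norm2E.
set u := matfun F (mxC L) *m _; set w := V *m _ *m _ *m _.
set y := horner_mx A _ *m c in e1 e2.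
have -> : u - w = (u - y) - (w - y) by rewrite opprB addrA subrK.
have s0 := nsq_ge0 _ (mxC b).
rewrite -(ler_pXn2r (_ : (0 < 2)%N)) ?nnegrE ?mulr_ge0 ?sqrtr_ge0//.
rewrite !exprMn !sqr_sqrtr ?nsq_ge0//.
(* The squares fit exactly: [2 M^2 + 2 M^2 = (2 M)^2]. *)
apply: le_trans (nsqB_le _ _ _) _.
move: e1 e2; rewrite -/w -/u.
lra.
Qed.

Lemma error_le (p : {poly R}) K M : crouzeix_constant L b xi V K -> (size p <= k.+1)%N -> 0 <= M ->
    (forall x, lmin <= x <= lmax -> `|f x - p.[x] / (Defs.qpoly xi).[x]| <= M) ->
  krylov_error L b V F <= 2 * K * norm2 (mxC b) * M.
Proof.
move=> hK sp M0 pM; have K0 := crouzeix_constant_ge0 _ _ hK; case: hK => _ sa _ qo.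
have [Lsym|Lns] := pselect (L^T = L).
  by rewrite (sa Lsym) mulr1; exact: selfadjoint_error_le pM.
apply: le_trans (qo Lns _ _ hF) _.
by rewrite ler_wpM2l ?mulr_ge0 ?sqrtr_ge0//; exact: best_approx_le pM.
Qed.

End ErrorBound.

(** * Interpolation at the negated poles *)

Section RationalApproximation.
Context {R : realType}.
Local Notation C := R[i].
Variables (k : nat) (lmin lmax : R) (xi : 'I_k -> R).
Hypothesis l0 : 0 < lmin.
Hypothesis xi_inj : injective xi.
Hypothesis hxi : forall j, - xi j \in `[lmin, lmax].

Definition nodes : seq R := [seq - xi j | j <- enum 'I_k].

Lemma size_nodes : size nodes = k.
Proof. by rewrite size_map size_enum_ord. Qed.

Lemma uniq_nodes : uniq nodes.
Proof. by rewrite map_inj_uniq ?enum_uniq// => i j /oppr_inj /xi_inj. Qed.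

Lemma nodes_itv : {in nodes, forall a, lmin <= a <= lmax}.
Proof. by move=> _ /mapP[j _ ->]; have := hxi j; rewrite in_itv. Qed.

Lemma nodes_gt0 : {in nodes, forall a, 0 < a}.
Proof. by move=> a /nodes_itv /andP[h _]; exact: lt_le_trans h. Qed.

Lemma rfunE x : rfun xi x = \prod_(a <- nodes) ((x - a) / (x + a)).
Proof. by rewrite big_map big_enum; apply: eq_bigr => j _; rewrite opprK. Qed.

Lemma qpoly_nodesE x : (Defs.qpoly xi).[x] = \prod_(a <- nodes) (x + a).
Proof.
by rewrite horner_prod big_map big_enum; apply: eq_bigr => j _; rewrite hornerXsubC.
Qed.

Lemma rfun_le_supnorm x : lmin <= x <= lmax -> `|rfun xi x| <= supnorm lmin lmax (rfun xi).
Proof.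
move=> xab; apply: ub_le_sup; last by exists x => //=; rewrite in_itv.
(* Boundedness by 1 ensures that [supnorm] is a true supremum. *)
exists 1 => z [y /=]; rewrite in_itv /= => /andP[ly _] <-.
by rewrite rfunE normr_blaschke_le1 ?(lt_le_trans l0 ly)//; exact: nodes_gt0.
Qed.

Lemma interp_error_le (f : R -> R) M x : 0 <= M -> lmin <= x <= lmax ->
    (x \notin nodes -> `|scaled_error nodes f x| <= M) ->
  `|interp_error nodes f x| <= M * supnorm lmin lmax (rfun xi).
Proof.
move=> M0 xab h; have x0 : 0 < x by case/andP: xab => lx _; exact: lt_le_trans lx.
have xa a : a \in nodes -> x + a != 0.
  by move=> as_; rewrite gt_eqF// addr_gt0// nodes_gt0.
have r0 := le_trans (normr_ge0 _) (rfun_le_supnorm x xab).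
have [xs|xs] := boolP (x \in nodes).
  by rewrite interp_error_node ?uniq_nodes// normr0 mulr_ge0.
rewrite interp_errorE ?uniq_nodes// -rfunE normrM mulrC ler_pM ?normr_ge0 ?h//.
exact: rfun_le_supnorm.
Qed.

End RationalApproximation.

(** * The three function classes and the final bound *)

Section Cases.
Context {R : realType}.
Local Notation C := R[i].
Variables (n k : nat) (L : 'M[R]_n.+1) (b : 'cV[R]_n.+1) (xi : 'I_k -> R).
Hypotheses (k0 : (0 < k)%N) (Ldiag : diagonalizable L) (Lpos : posdefmx L).
Hypothesis xi_inj : injective xi.
Hypothesis hxi : forall j, - xi j \in `[lambda_min L, lambda_max L].
Variables (f : R -> R) (F : C -> C) (V : 'M[C]_(n.+1, k.+1)) (K : R).
Hypotheses (hF : holo_ext f F) (hV : rat_krylov_basis L b xi V).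
Hypothesis hK : crouzeix_constant L b xi V K.

Local Notation lmin := (lambda_min L).
Local Notation lmax := (lambda_max L).
Local Notation r := (sigma_norm L (rfun xi)).
Local Notation s := (nodes k xi).

Let l0 : 0 < lmin := lambda_min_gt0 _ L Ldiag Lpos.

(** The factor [p0] is 1 for the Laplace and Cauchy classes, and ['X] with [g x = f x / x] for
    complete Bernstein functions. *)
Lemma interp_error_krylov (g : R -> R) (M : R) (p0 : {poly R}) : (size p0 <= 2)%N -> 0 <= M ->
    (forall x, lmin <= x <= lmax -> f x = p0.[x] * g x) ->
    (forall x, lmin <= x <= lmax -> `|p0.[x] * interp_error s g x| <= M) ->
  krylov_error L b V F <= 2 * K * norm2 (mxC b) * M.
Proof.
move=> sp0 M0 fg gM; have [p sp pE] := interp_errorP s g.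
apply: (error_le n k L b xi Ldiag Lpos hxi V F f hV hF (p0 * p)) => // [|x xab].
  apply: leq_trans (size_polyMleq _ _) _; rewrite -(size_nodes k xi).
  by move: sp0 sp; rewrite -subn1 leq_subLR => h1 h2; exact: leq_add h1 h2.
rewrite qpoly_nodesE hornerM fg// -mulrA -mulrBr -pE; exact: gM.
Qed.

Lemma CS_error : CS f -> krylov_error L b V F <= 2 * K * norm2 (mxC b) * (f lmin * r).
Proof.
move=> [w dw wf]; have wf' : cauchy_transform w f := wf.
have f0 := cauchy_transform_ge0 _ _ _ dw wf' l0.
apply: (interp_error_krylov f _ 1); rewrite ?size_poly1//.
- by rewrite mulr_ge0// supnorm_ge0.
- by move=> x _; rewrite hornerC mul1r.
move=> x xab; rewrite hornerC mul1r.
apply: interp_error_le => // xs; have x0 : 0 < x by case/andP: xab => h _; exact: lt_le_trans h.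
apply: le_trans (cauchy_transform_scaled_error _ _ _ _ dw wf' _ _ x0 xs) _.
- exact: uniq_nodes.
- exact: nodes_gt0 hxi.
by apply: cauchy_transform_nincr wf' l0 _ => //; case/andP: xab.
Qed.

Lemma CB_error : CB f -> krylov_error L b V F <= 2 * K * norm2 (mxC b) * (f lmax * r).
Proof.
move=> cb; have [w dw wf] := CB_cauchy_transform _ cb.
have pos x : lmin <= x <= lmax -> 0 < x by case/andP => h _; exact: lt_le_trans h.
have f0 x : lmin <= x <= lmax -> 0 <= f x.
  move=> /pos x0; have := cauchy_transform_ge0 _ _ _ dw wf x0.
  by rewrite pmulr_lge0 ?invr_gt0.
apply: (interp_error_krylov (fun x => f x / x) _ 'X); rewrite ?size_polyX//.
- by rewrite mulr_ge0 ?supnorm_ge0// f0// lexx andbT lambda_min_le_max.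
- by move=> x /pos x0; rewrite hornerX mulrC divfK// gt_eqF.
move=> x xab; have x0 := pos x xab.
rewrite hornerX normrM (gtr0_norm x0).
apply: le_trans (_ : x * (f x / x * r) <= _); last first.
  rewrite (_ : x * _ = f x * r); last by field; rewrite gt_eqF.
  by rewrite ler_wpM2r ?supnorm_ge0//; apply: CB_ndecr cb x0 _; case/andP: xab.
rewrite ler_wpM2l ?(ltW x0)//; apply: interp_error_le => //.
  by rewrite divr_ge0 ?f0// ltW.
move=> xs; apply: cauchy_transform_scaled_error wf _ _ x0 xs => //.
- exact: uniq_nodes.
- exact: nodes_gt0 hxi.
Qed.

Lemma LS_error : LS f ->
  ((krylov_error L b V F)%:E <=
    (2 * K)%:E * ((4 * gamma lmin lmax k)%:E * lim ((f x)%:E @[x --> 0^'+])) *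
     (norm2 (mxC b))%:E * r%:E)%E.
Proof.
move=> [mu muf]; have muf' : laplace_transform mu f := muf.
have K0 := crouzeix_constant_ge0 _ _ _ _ _ Ldiag _ _ hK.
have b0 : 0 <= norm2 (mxC b) by rewrite sqrtr_ge0.
have r0 := supnorm_ge0 n L (rfun xi).
have pos x : lmin <= x <= lmax -> 0 < x by case/andP => h _; exact: lt_le_trans h.
have mass := laplace_transform_mass _ _ muf'.
have E x := laplace_transform_scaled_error mu f s lmin lmax x muf'.
(* Positive because it dominates some [2 + N]. *)
have g0 : 0 < 4 * gamma lmin lmax k.
  have [N _] := dyadic_gamma lmin lmax lmin k k0 l0 (lambda_min_le_max _ L Ldiag) (lexx _).
  by apply: lt_le_trans; rewrite ltr_wpDr.
have lim0 := le_trans (measure_ge0 mu _) mass.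
have err M : 0 <= M -> (forall x, lmin <= x <= lmax -> x \notin s -> `|scaled_error s f x| <= M) ->
    krylov_error L b V F <= 2 * K * norm2 (mxC b) * (M * r).
  move=> M0 hM; apply: (interp_error_krylov f _ 1); rewrite ?size_poly1 ?mulr_ge0//.
    by move=> x _; rewrite hornerC mul1r.
  move=> x xab; rewrite hornerC mul1r; apply: interp_error_le => //; exact: hM.
move: lim0 E; case: (lim _) => [l| |//] l0' E.
  rewrite -!EFinM lee_fin.
  rewrite (_ : _ * r = 2 * K * norm2 (mxC b) * (4 * gamma lmin lmax k * l * r)); last by ring.
  apply: err => [|x xab xs]; first by rewrite mulr_ge0// ltW.
  have := E x; rewrite size_nodes -EFinM lee_fin; apply=> //.
  - exact: uniq_nodes.
  - exact: nodes_itv hxi.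
(* Here the limit is [+oo]. The right-hand side is then [+oo] unless one of the other factors
   vanishes; in that case it is 0, as [0 * +oo = 0], and the error itself must be at most 0. *)
have z : krylov_error L b V F <= 0 \/ [/\ 0 < 2 * K, 0 < norm2 (mxC b) & 0 < r].
  have lm := lambda_min_le_max _ L Ldiag.
  (* Approximating by [p = 0] gives a finite bound, which settles [K = 0] and [b = 0]. When [r = 0]
     the interpolation error vanishes on the whole interval. *)
  have triv : krylov_error L b V F <= 2 * K * norm2 (mxC b) * f lmin.
    apply: (error_le n k L b xi Ldiag Lpos hxi V F f hV hF 0) => //.
    - by rewrite size_poly0.
    - exact: laplace_transform_ge0 muf' l0.
    move=> x xab; have x0 := pos x xab; rewrite horner0 mul0r subr0.
    rewrite ger0_norm ?(laplace_transform_ge0 _ _ _ muf' x0)//.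
    by apply: laplace_transform_nincr muf' l0 _; case/andP: xab.
  have [Kz|K1] := eqVneq K 0; first by left; move: triv; rewrite Kz mulr0 !mul0r.
  have [bz|b1] := eqVneq (norm2 (mxC b)) 0; first by left; move: triv; rewrite bz mulr0 mul0r.
  have [rz|r1] := eqVneq r 0; last first.
    by right; split; [rewrite mulr_gt0// lt_def K1 | rewrite lt_def b1 | rewrite lt_def r1].
  left; rewrite -(mulr0 (2 * K * norm2 (mxC b))).
  apply: (interp_error_krylov f _ 1); rewrite ?size_poly1//.
    by move=> x _; rewrite hornerC mul1r.
  move=> x xab; rewrite hornerC mul1r.
  have xa a : a \in s -> x + a != 0.
    by move=> as_; rewrite gt_eqF// addr_gt0 ?(pos _ xab) ?(nodes_gt0 _ _ _ _ l0 hxi).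
  have [xs|xs] := boolP (x \in s).
    by rewrite interp_error_node ?uniq_nodes// normr0.
  rewrite interp_errorE ?uniq_nodes// -rfunE.
  have := rfun_le_supnorm _ _ _ _ l0 hxi x xab; rewrite -/(sigma_norm L _) rz normr_le0 => /eqP ->.
  by rewrite mul0r normr0.
have [le|[K1 b1 r1]] := z.
  apply: (@le_trans _ _ 0%E); first by rewrite lee_fin.
  by rewrite !mule_ge0 ?lee_fin ?(ltW g0) ?mulr_ge0 ?leey.
by rewrite gt0_muley ?lte_fin// gt0_muley ?lte_fin// gt0_mulye ?lte_fin// gt0_mulye ?lte_fin// leey.
Qed.

End Cases.

Theorem theorem7 (R : realType) (n k : nat) (hk : (0 < k)%N)
    (L : 'M[R]_n.+1) (Ldiag : diagonalizable L) (Lpos : posdefmx L)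
    (b : 'cV[R]_n.+1) (f : R -> R) (hf : SB f)
    (F : R[i] -> R[i]) (hF : holo_ext f F)
    (xi : 'I_k -> R) (xi_inj : injective xi)
    (hxi : forall j, - xi j \in `[lambda_min L, lambda_max L])
    (V : 'M[R[i]]_(n.+1, k.+1)) (hV : rat_krylov_basis L b xi V)
    (K : R) (hK : crouzeix_constant L b xi V K)
    (c : \bar R) (hc : error_constant f (lambda_min L) (lambda_max L) k c) :
  ((krylov_error L b V F)%:E <=
     (2 * K)%:E * c * (norm2 (mxC b))%:E * (sigma_norm L (rfun xi))%:E)%E.
Proof.
case: hc => [[ls ->]|[cs ->]|[cb ->]].
- exact: LS_error ls.
- rewrite -!EFinM lee_fin; apply: le_trans (CS_error _ _ _ _ _ Ldiag Lpos xi_inj hxi _ _ _ _ hF hV hK cs) _.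
  by rewrite le_eqVlt; apply/orP; left; apply/eqP; ring.
- rewrite -!EFinM lee_fin; apply: le_trans (CB_error _ _ _ _ _ Ldiag Lpos xi_inj hxi _ _ _ _ hF hV hK cb) _.
  by rewrite le_eqVlt; apply/orP; left; apply/eqP; ring.
Qed.
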